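(* Let $f:[0,1]\to\mathbb{R}$ be a $C^2$ function such that $f'(0)\ge 0$, $\inf_{[0,1]} f''>0$, $f'''$ exists and is bounded on $(0,1)$, and $f'f'''-(f'')^2\le 0$ on $(0,1)$. Then there exist a compact set $K\subseteq\mathbb{R}^2$ of two-dimensional Lebesgue measure $0$ and a constant $c>0$ such that for every $a\in[1,2]$, $K$ contains a translated copy of a piece of length at least $c$ of the graph of $x\mapsto af(x)$, i.e. there exist $(x_1,x_2)\in\mathbb{R}^2$ and an interval $I_a\subseteq[0,1]$ of length at least $c$ with $\{(x_1+t,\,x_2+af(t)):t\in I_a\}\subseteq K$. Moreover, there is a constant $C$ such that $|K(\delta)|\le C(\log\delta^{-1})^{-2}$ for all sufficiently small $\delta>0$. Consequently, for all $p,q\in[1,\infty]$ there is $c_{p,q}>0$ independent of $\delta$ with $$R(p,q,\delta)\ge c_{p,q}(\log\delta^{-1})^{2/p}$$ for all sufficiently small $\delta>0$. In particular, $R(p,q)=\infty$ whenever $p<\infty$.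
   Context: For $S\subseteq\mathbb{R}^2$ and $\delta>0$, the vertical $\delta$-thickening is $S(\delta):=\{x+(0,\varepsilon): x\in S,\ -\delta\le\varepsilon\le\delta\}$. For $g:\mathbb{R}^2\to\mathbb{C}$ and $a\in[1,2]$ define $$\mathcal R g(a)=\sup_{(x_1,x_2)\in\mathbb{R}^2}\int_0^1|g(x_1+t,\,x_2+af(t))|\,dt,\qquad \mathcal R_\delta g(a)=\sup_{(x_1,x_2)\in\mathbb{R}^2}(2\delta)^{-1}\int_0^1\int_{-\delta}^{\delta}|g(x_1+t,\,x_2+af(t)+s)|\,ds\,dt,$$ and for $p,q\in[1,\infty]$ let $R(p,q)=\sup_{g\ne0}\|\mathcal R g\|_{L^q([1,2])}/\|g\|_{L^p(\mathbb{R}^2)}$ and $R(p,q,\delta)=\sup_{g\ne0}\|\mathcal R_\delta g\|_{L^q([1,2])}/\|g\|_{L^p(\mathbb{R}^2)}$. $|\cdot|$ denotes Lebesgue measure. *)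

(* Defs.v *)
From HB Require Import structures.
From mathcomp Require Import all_boot all_order all_algebra.
From mathcomp Require Import all_classical all_reals all_analysis.
From mathcomp Require complex.

Set Implicit Arguments.
Unset Strict Implicit.
Unset Printing Implicit Defensive.

Import Order.TTheory GRing.Theory Num.Theory.
Import numFieldNormedType.Exports.

Local Open Scope classical_set_scope.
Local Open Scope ring_scope.

Section Defs.
Context {R : realType}.
Local Notation mu := (@lebesgue_measure R).

Definition cabs (z : complex.complex R) : R :=
  Num.sqrt (complex.Re z ^+ 2 + complex.Im z ^+ 2).

Definition leb2 : set (R * R) -> \bar R := (mu \x mu)%E.

Definition deriv01 (f f' : R -> R) : Prop :=
  forall x, x \in `[0, 1] ->
    (fun h : R => h^-1 * (f (x + h) - f x))
      @ within [set h | h != 0 /\ x + h \in `[0, 1]] (nbhs (0:R)) --> f' x.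

Definition vthick (S : set (R * R)) (delta : R) : set (R * R) :=
  [set z | exists x e, [/\ S x, - delta <= e <= delta & z = (x.1, x.2 + e)]].

Definition Rmaxop (f : R -> R) (g : R * R -> complex.complex R) (a : R)
  : \bar R :=
  ereal_sup [set (\int[mu]_(t in `[0%R, 1%R]) (cabs (g (x.1 + t, x.2 + a * f t)))%:E)%E
            | x in [set: R * R]].

Definition Rdeltaop (f : R -> R) (delta : R) (g : R * R -> complex.complex R)
  (a : R) : \bar R :=
  ereal_sup [set ((2 * delta)^-1%:E *
     \int[mu]_(t in `[0%R, 1%R]) \int[mu]_(s in `[(- delta)%R, delta])
        (cabs (g (x.1 + t, x.2 + a * f t + s)))%:E)%E
            | x in [set: R * R]].

Definition gnorm (p : \bar R) (g : R * R -> complex.complex R) : \bar R :=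
  Lnorm (mu \x mu)%E p (fun z => (cabs (g z))%:E).

Definition norm12 (q : \bar R) (F : R -> \bar R) : \bar R :=
  Lnorm mu q (fun a => if a \in `[1, 2] then F a else 0%E).

Definition admissible (p : \bar R) (g : R * R -> complex.complex R) : Prop :=
  [/\ measurable_fun [set: R * R] (fun z => complex.Re (g z)),
      measurable_fun [set: R * R] (fun z => complex.Im (g z)) &
      (0 < gnorm p g < +oo)%E].

Definition Rpq (f : R -> R) (p q : \bar R) : \bar R :=
  ereal_sup [set (norm12 q (Rmaxop f g) * (fine (gnorm p g))^-1%:E)%E
            | g in admissible p].

Definition Rpqd (f : R -> R) (p q : \bar R) (delta : R) : \bar R :=
  ereal_sup [set (norm12 q (Rdeltaop f delta g) * (fine (gnorm p g))^-1%:E)%E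
            | g in admissible p].

(** the exponent 2/p, with 2/oo = 0 *)
Definition two_over (p : \bar R) : R :=
  match p with r%:E => 2 / r | _ => 0 end.

End Defs.

(* Main.v *)
(** The set [K] is built from a binary tree of curves [y = a f(x - xi) + eta], the node
at level [n] recording the first [n] binary digits of [a].  Turning a digit on at
level [n + 1] changes [a] by [2^-(n+1)], and the new translation is chosen so that the
new curve is tangent to the old one above the abscissa [osc (n + 1)]; the two curves
then differ by [O(2^-n (x - osc (n + 1))^2)].  The abscissas move by [O(1/n)] per level,
so all descendants of a node of level [n] stay within
[O(2^-n ((x - osc n)^2 + 1/n^2))] of it.  As [osc] keeps sweeping the window
[2/5, 3/5], every [x] admits a level [n], comparable to [log(1/delta)], with
[|x - osc n| <= 1/n]; there the vertical section of [K] is covered by [O(2^n)]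
intervals of length [O(2^-n / n^2 + delta)], of total length [O(1/n^2)].  Starting
the tree at a deep level [k0] keeps all horizontal translations below [1/5], which
leaves a common piece of length [1/5].  The bounds on the maximal operators follow by
testing on the indicator function of the thickened set. *)

Require Import Defs.
From HB Require Import structures.
From mathcomp Require Import all_boot all_order all_algebra.
From mathcomp Require Import all_classical all_reals all_analysis.
From mathcomp Require Import ess_sup_inf measurable_realfun.
From mathcomp Require complex.
From mathcomp Require Import ring lra.

Import Order.TTheory GRing.Theory Num.Theory.
Import numFieldNormedType.Exports.

Local Open Scope classical_set_scope.
Local Open Scope ring_scope.

Set Implicit Arguments.
Unset Strict Implicit.
Unset Printing Implicit Defensive.

(** * Measurability of compact plane sets, and planar measure by vertical sections *)

Section Measure.
Context {R : realType}.
Local Notation mu := (@lebesgue_measure R).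

(** The integral of a nonnegative function is a supremum over the simple functions below it, so it
    is monotone even for functions not known to be measurable, such as the maximal functions. *)
Lemma nonneg_le_integral d (T : measurableType d) (m : {measure set T -> \bar R})
    (D : set T) (f g : T -> \bar R) :
  (forall x, D x -> 0 <= f x)%E -> (forall x, D x -> f x <= g x)%E ->
  (\int[m]_(x in D) f x <= \int[m]_(x in D) g x)%E.
Proof.
move=> f0 fg.
have g0 x : D x -> (0 <= g x)%E by move=> Dx; apply: le_trans (f0 _ Dx) (fg _ Dx).
rewrite !ge0_integralE//; apply: ereal_sup_le => _ [h hf <-].
exists h => //= x; apply: le_trans (hf x) _.
rewrite !patchE; case: ifPn => // /set_mem; exact: fg.
Qed.

(** The countably many open boxes with rational corners form a base of the plane, and each of them
    is measurable for the product structure. *)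
Lemma open_prod_measurable (U : set (R * R)) : open U -> measurable U.
Proof.
move=> oU.
pose box (q : rat * rat * (rat * rat)) : set (R * R) :=
  `]ratr q.1.1, ratr q.1.2[ `*` `]ratr q.2.1, ratr q.2.2[.
have -> : U = \bigcup_q (if `[< box q `<=` U >] then box q else set0).
  apply/seteqP; split=> [p Up|p [q _]]; last by case: asboolP => // /(_ p).
  have /nbhs_ballP[e /= e0 He] := open_nbhs_nbhs (conj oU Up).
  have [a1 /[!in_itv]/=/andP[ha1 ha1']] := @rat_in_itvoo R (p.1 - e) p.1 ltac:(lra).
  have [b1 /[!in_itv]/=/andP[hb1 hb1']] := @rat_in_itvoo R p.1 (p.1 + e) ltac:(lra).
  have [a2 /[!in_itv]/=/andP[ha2 ha2']] := @rat_in_itvoo R (p.2 - e) p.2 ltac:(lra).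
  have [b2 /[!in_itv]/=/andP[hb2 hb2']] := @rat_in_itvoo R p.2 (p.2 + e) ltac:(lra).
  exists ((a1, b1), (a2, b2)) => //.
  case: asboolP => [_|[]]; first by split; rewrite /= in_itv/=; apply/andP.
  move=> [x y] [/= /[!in_itv]/=/andP[hx hx'] /andP[hy hy']].
  by apply: He; split; rewrite /ball/= ltr_norml; lra.
apply: countable_bigcupT_measurable => [|q]; first exact: countableP.
by case: asboolP => // _; apply: measurableX.
Qed.

Lemma compact_prod_measurable (K : set (R * R)) : compact K -> measurable K.
Proof.
move=> cK.
have oK : open (~` K).
  by apply: closed_openC; apply: (compact_closed (@norm_hausdorff R (R * R)%type)).
by rewrite -[K]setCK; apply: measurableC; exact: open_prod_measurable.
Qed.

(** The thickening is the continuous image of [K] times a segment under addition in the second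
    coordinate. *)
Lemma vthick_compact (K : set (R * R)) (e : R) : compact K -> compact (vthick K e).
Proof.
move=> cK.
have -> : vthick K e = (fun p : (R * R) * R => (p.1.1, p.1.2 + p.2)) @` (K `*` `[- e, e]).
  apply/seteqP; split=> [z [x [t [Kx ht ->]]]|_ [[x t] [/= Kx ht] <-]].
    by exists (x, t) => //; split => //=; rewrite in_itv.
  by exists x, t; split => //; rewrite in_itv in ht.
apply: continuous_compact; last first.
  by apply: compact_setX => //; exact: segment_compact.
apply: continuous_subspaceT => p.
have h1 : (fun q : R * R * R => q.1.1) @ p --> p.1.1.
  exact: (cvg_comp _ _ cvg_fst cvg_fst).
have h2 : (fun q : R * R * R => q.1.2) @ p --> p.1.2.
  exact: (cvg_comp _ _ cvg_fst cvg_snd).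
have h3 : (fun q : R * R * R => q.1.2 + q.2) @ p --> p.1.2 + p.2.
  by apply: cvgD => //; exact: cvg_snd.
exact: (cvg_pair h1 h3).
Qed.

Lemma lebesgue_measure_itvcc (u v : R) : u <= v -> mu `[u, v] = (v - u)%:E.
Proof.
rewrite lebesgue_measure_itv/= lte_fin le_eqVlt => /predU1P[->|->//].
by rewrite ltxx subrr.
Qed.

Lemma mu_finite_cover (S : set R) (c : nat -> R) (r : R) (n : nat) :
  measurable S -> 0 <= r ->
  (forall y, S y -> exists2 i, (i < n)%N & `|y - c i| <= r) ->
  (mu S <= (n%:R * (2 * r))%:E)%E.
Proof.
move=> mS r0 hS.
pose I i := `[c i - r, c i + r]%classic.
apply: (@le_trans _ _ (mu (\big[setU/set0]_(i < n) I i))).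
  apply: le_measure; rewrite ?inE//.
    by apply: bigsetU_measurable => i _; exact: measurable_itv.
  move=> y /hS[i ni]; rewrite ler_distl => /andP[h1 h2].
  by rewrite -bigcup_mkord; exists i => //; rewrite /I/= in_itv/= h1 h2.
apply: (@le_trans _ _ (\sum_(i < n) mu (I i))%E).
  by apply: Boole_inequality => i _; exact: measurable_itv.
rewrite (eq_bigr (fun=> (2 * r)%:E)); last first.
  move=> i _; rewrite /I.
  by rewrite [LHS]lebesgue_measure_itvcc; [congr (_%:E); lra | lra].
by rewrite sumEFin sumr_const card_ord -[in leLHS](mulr_natl (2 * r)).
Qed.

Lemma integral_cst_itvcc (u v B : R) : u <= v -> 0 <= B ->
  (\int[mu]_x (B * \1_(`[u, v]) x)%:E = (B * (v - u))%:E)%E.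
Proof.
move=> uv B0; under eq_integral do rewrite EFinM.
rewrite ge0_integralZl//; last first.
  by apply/measurable_EFinP/measurable_indic; exact: measurable_itv.
rewrite integral_indic// setIT EFinM; congr (_ * _)%E.
exact: lebesgue_measure_itvcc.
Qed.

(** The product measure is by definition the integral of the measures of the vertical sections; here
    they are compared with [B] times the indicator of [[u, v]]. *)
Lemma leb2_le (A : set (R * R)) (u v B : R) : u <= v -> 0 <= B ->
  (forall x, x \in `[u, v] -> mu (xsection A x) <= B%:E)%E ->
  (forall x, x \notin `[u, v] -> xsection A x = set0) ->
  (leb2 A <= (B * (v - u))%:E)%E.
Proof.
move=> uv B0 h1 h2; rewrite -integral_cst_itvcc//.
apply: nonneg_le_integral => // x _.
case: (boolP (x \in `[u, v])) => hx /=.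
  by rewrite indicE mem_set//= mulr1; exact: h1.
by rewrite h2// measure0 lee_fin mulr_ge0.
Qed.

Lemma leb2_ge (A : set (R * R)) (u v B : R) : u <= v -> 0 <= B ->
  (forall x, x \in `[u, v] -> B%:E <= mu (xsection A x))%E ->
  ((B * (v - u))%:E <= leb2 A)%E.
Proof.
move=> uv B0 h1; rewrite -integral_cst_itvcc//.
apply: nonneg_le_integral => // x _; first by rewrite lee_fin mulr_ge0.
rewrite indicE; case: (boolP (x \in `[u, v])) => hx /=.
  by rewrite mem_set//= mulr1; exact: h1.
by rewrite memNset ?mulr0//; exact/negP.
Qed.

End Measure.

(** * Testing the maximal operators on indicator functions *)

Section MaximalOperators.
Context {R : realType}.
Local Notation mu := (@lebesgue_measure R).

Definition cindic (A : set (R * R)) (z : R * R) : complex.complex R :=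
  complex.Complex (\1_A z) 0.

Lemma cabs_cindic A z : cabs (cindic A z) = \1_A z.
Proof. by rewrite /cabs /= expr0n addr0 sqrtr_sqr ger0_norm. Qed.

Lemma gnorm_cindic (r : R) A : 0 < r -> measurable A ->
  Defs.gnorm r%:E (cindic A) = (leb2 A `^ r^-1)%E.
Proof.
move=> r0 mA; rewrite /Defs.gnorm unlock; congr (_ `^ _)%E.
transitivity (\int[(mu \x mu)%E]_z (\1_A z)%:E)%E; last first.
  by rewrite integral_indic// setIT.
apply: eq_integral => z _; rewrite cabs_cindic /= ger0_norm//.
by rewrite indicE; case: (z \in A); rewrite /= ?powR1 ?powR0// gt_eqF.
Qed.

Lemma gnormy_cindic A : (0 < leb2 A)%E -> measurable A ->
  (0 < Defs.gnorm +oo%E (cindic A) <= 1)%E.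
Proof.
move=> A0 mA; rewrite /Defs.gnorm unlock.
(* At exponent infinity the norm is defined by cases: it is the essential supremum only if the whole
   space has positive measure. *)
have -> : (0 < (mu \x mu)%E [set: R * R])%E.
  by apply: lt_le_trans A0 _; apply: le_measure; rewrite ?inE.
apply/andP; split; last first.
  apply/ess_supP; apply: aeW => z /=.
  by rewrite cabs_cindic ger0_norm// lee_fin indicE; case: (_ \in _).
rewrite ltNge; apply/negP => /ess_supP [N [mN N0 hN]].
move: A0; rewrite lt_neqAle => /andP[/eqP + _]; apply; apply/esym.
have AN : A `<=` N by move=> z Az; apply: hN => /=;
  rewrite cabs_cindic indicE mem_set// normr1 lee_fin ler10.
exact: (@subset_measure0 _ _ _ (mu \x mu)%E A N mA mN AN N0).
Qed.

Lemma le_poweR (r : R) (x y : \bar R) : 0 <= r -> (0 <= x)%E -> (x <= y)%E ->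
  (x `^ r <= y `^ r)%E.
Proof.
by move=> r0 x0 xy; apply: gt0_ler_poweR; rewrite ?in_itv/= ?leey ?andbT ?(le_trans x0).
Qed.

(** Since [[1, 2]] has length 1, the constant [c] has norm [c] for every exponent. *)
Lemma norm12_ge (q : \bar R) (F : R -> \bar R) (c : R) : (1 <= q)%E -> 0 <= c ->
  (forall a, a \in `[1, 2] -> (c%:E <= F a)%E) -> (c%:E <= norm12 q F)%E.
Proof.
move=> q1 c0 cF; rewrite /norm12 unlock.
have mI : mu `[1, 2] = 1%E by rewrite lebesgue_measure_itvcc; [congr (_%:E)|]; lra.
case: q q1 => [r|_|//].
- rewrite lee_fin => r1; have r0 : 0 < r by lra.
  have -> : c%:E = ((c `^ r)%:E `^ r^-1)%E.
    by rewrite poweR_EFin -powRrM mulfV ?gt_eqF// powRr1.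
  apply: le_poweR; rewrite ?invr_ge0 ?lee_fin ?powR_ge0 ?(ltW r0)//.
  have -> : (c `^ r)%:E = (\int[mu]_x (c `^ r * \1_(`[1, 2]) x)%:E)%E.
    by rewrite integral_cst_itvcc ?powR_ge0//; [congr (_%:E); ring | lra].
  apply: nonneg_le_integral => x _; first by rewrite lee_fin mulr_ge0// powR_ge0.
  rewrite indicE; case: ifPn => hx.
    rewrite mem_set//= mulr1 -poweR_EFin.
    apply: le_poweR; rewrite ?(ltW r0) ?lee_fin//.
    exact: le_trans (cF _ hx) (lee_abs _).
  by rewrite memNset ?mulr0 ?poweR_ge0//; exact/negP.
- have T0 : (0 < mu [set: R])%E.
    apply: (@lt_le_trans _ _ (mu `[1, 2])); first by rewrite mI.
    by apply: le_measure; rewrite ?inE.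
  rewrite T0 leNgt; apply/negP => h.
  have /ess_supP [N [mN N0 hN]] := lexx (ess_sup mu (abse \o (fun a => if a \in `[1, 2] then F a else 0%E))).
  have : mu `[1, 2] = 0%E.
    apply: (subset_measure0 _ mN _ N0) => // a ha; apply: hN => /= ha2.
    have := le_lt_trans ha2 h; rewrite ifT// ltNge => /negP; apply.
    by apply: le_trans (cF _ _) (lee_abs _).
  by rewrite mI => /eqP; rewrite onee_eq0.
Qed.

Lemma Rmaxop_cindic_ge (f : R -> R) A (a x1 x2 u v : R) :
  0 <= u -> u <= v -> v <= 1 ->
  (forall t, t \in `[u, v] -> A (x1 + t, x2 + a * f t)) ->
  ((v - u)%:E <= Rmaxop f (cindic A) a)%E.
Proof.
move=> u0 uv v1 hA; apply: le_trans; last by apply: ereal_sup_ubound; exists (x1, x2).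
rewrite -[v - u]mul1r -integral_cst_itvcc// [leRHS]integral_mkcond.
apply: nonneg_le_integral => [t _|t _]; first by rewrite mul1r lee_fin.
rewrite mul1r patchE cabs_cindic !indicE /=.
case: (boolP (t \in `[u, v])) => ht.
  have ht1 : t \in `[0, 1] by move: ht; rewrite !in_itv/=; lra.
  by rewrite !mem_set//=; exact: hA.
by rewrite memNset; [case: ifP => // _; rewrite lee_fin|exact/negP].
Qed.

(** For [t] in [[u, v]] the inner integral has its full value [2 * delta], which cancels the
    normalising factor. *)
Lemma Rdeltaop_cindic_ge (f : R -> R) A (delta a x1 x2 u v : R) : 0 < delta ->
  0 <= u -> u <= v -> v <= 1 ->
  (forall t s, t \in `[u, v] -> s \in `[- delta, delta] ->
     A (x1 + t, x2 + a * f t + s)) ->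
  ((v - u)%:E <= Rdeltaop f delta (cindic A) a)%E.
Proof.
move=> d0 u0 uv v1 hA; apply: le_trans; last by apply: ereal_sup_ubound; exists (x1, x2).
have -> : (v - u)%:E = ((2 * delta)^-1%:E * (2 * delta * (v - u))%:E)%E.
  by rewrite -EFinM; congr (_%:E); field; rewrite gt_eqF.
apply: lee_wpmul2l; first by rewrite lee_fin invr_ge0; lra.
rewrite -integral_cst_itvcc//; last lra.
rewrite [leRHS]integral_mkcond.
apply: nonneg_le_integral => [t _|t _].
  by rewrite lee_fin mulr_ge0//; lra.
rewrite patchE; case: (boolP (t \in `[u, v])) => ht.
  have ht1 : t \in `[0, 1] by move: ht; rewrite !in_itv/=; lra.
  rewrite indicE !mem_set//= mulr1.
  have -> : (2 * delta)%:E = (1 * (delta - - delta))%:E by congr (_%:E); ring.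
  rewrite -integral_cst_itvcc//; last lra.
  rewrite [leRHS]integral_mkcond.
  apply: nonneg_le_integral => [s _|s _]; first by rewrite mul1r lee_fin.
  rewrite mul1r patchE cabs_cindic !indicE /=.
  case: (boolP (s \in `[- delta, delta])) => hs.
    by rewrite !mem_set//=; exact: hA.
  by rewrite memNset; [|exact/negP].
rewrite indicE memNset ?mulr0; last exact/negP.
by case: ifP => // _; apply: integral_ge0 => s _; rewrite lee_fin cabs_cindic.
Qed.

(** One statement serves both operators. Dividing by the norm of the indicator of [A], at most the
    power [1/p] of [C * L ^- 2], produces the factor [L] to the power [2/p]. The exponent [1/p] is
    written [two_over p / 2] so that it is 0 at [p = +oo], where the norm is at most 1. *)
Lemma ratio_cindic_ge (p q : \bar R) (A : set (R * R))
    (Op : (R * R -> complex.complex R) -> R -> \bar R) (c C L : R) :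
  (1 <= p)%E -> (1 <= q)%E -> measurable A -> 0 <= c -> 0 < C -> 0 < L ->
  (0 < leb2 A <= (C * L ^- 2)%:E)%E ->
  (forall a, a \in `[1, 2] -> (c%:E <= Op (cindic A) a)%E) ->
  ((c / C `^ (two_over p / 2) * L `^ two_over p)%:E <=
   ereal_sup [set norm12 q (Op g) * (fine (Defs.gnorm p g))^-1%:E | g in admissible p])%E.
Proof.
move=> p1 q1 mA c0 C0 L0 /andP[A0 AC] cOp.
have CL0 : 0 < C * L ^- 2 by rewrite mulr_gt0// invr_gt0 exprn_gt0.
have Cp0 : 0 < C `^ (two_over p / 2) by rewrite powR_gt0.
suff [gn0 gn] : (0 < Defs.gnorm p (cindic A))%E /\
    (Defs.gnorm p (cindic A) <= (C `^ (two_over p / 2) * (L `^ two_over p)^-1)%:E)%E.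
  have [g gE] : exists g, Defs.gnorm p (cindic A) = g%:E.
    by case: (Defs.gnorm p _) gn0 gn => // g _ _; exists g.
  move: gn0 gn; rewrite gE lte_fin lee_fin => g0 gL.
  have adm : admissible p (cindic A).
    split=> /=; [exact/measurable_indic | exact: measurable_cst |].
    by rewrite gE lte_fin g0 ltry.
  apply: le_trans; last by apply: ereal_sup_ubound; exists (cindic A).
  rewrite gE /=; apply: (@le_trans _ _ (c%:E * g^-1%:E)%E).
    rewrite -EFinM lee_fin -mulrA ler_wpM2l// -[leLHS]invrK lef_pV2 ?posrE//.
      by rewrite invfM invrK.
    by rewrite invr_gt0 mulr_gt0 ?invr_gt0 ?powR_gt0.
  by apply: lee_wpmul2r; [rewrite lee_fin invr_ge0 ltW | exact: norm12_ge].
case: p p1 Cp0 => [r|_ _|//].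
- rewrite lee_fin => r1 _; have r0 : 0 < r by lra.
  rewrite gnorm_cindic//; split; first exact: poweR_gt0.
  have -> : (C `^ (two_over r%:E / 2) / L `^ two_over r%:E)%:E = ((C * L ^- 2)%:E `^ r^-1)%E.
    rewrite poweR_EFin powRM ?invr_ge0 ?exprn_ge0//; try exact: ltW.
    rewrite /two_over mulrAC divff ?mul1r//; congr (_ * _)%:E.
    by rewrite -powRN -(powR_invn 2 (ltW L0)) -powRrM mulNr.
  by apply: le_poweR; rewrite ?invr_ge0 ?(ltW r0) ?(ltW A0).
- have /andP[h1 h2] := gnormy_cindic A0 mA.
  by rewrite h1 /= mul0r !powRr0 invr1 mulr1.
Qed.

End MaximalOperators.

(** * Mean value estimates on an open interval *)

Section Calculus.
Context {R : realType}.
Implicit Types (f g : R -> R) (a u v x y : R).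

(** The order of [x] and [y] is left open; that [c] lies between them is retained only as a bound on
    its distance to [y]. *)
Lemma MVT_between g (g' : R -> R) u v x y :
  (forall z, z \in `]u, v[ -> is_derive z 1 g (g' z)) ->
  x \in `]u, v[ -> y \in `]u, v[ ->
  exists c, [/\ c \in `]u, v[, `|c - y| <= `|x - y| & g x - g y = g' c * (x - y)].
Proof.
move=> dg.
have mvt s t : s <= t -> s \in `]u, v[ -> t \in `]u, v[ ->
    exists2 c, (s <= c <= t) && (c \in `]u, v[) & g t - g s = g' c * (t - s).
  move=> st hs ht.
  have sub z : z \in `[s, t] -> z \in `]u, v[.
    by move: hs ht; rewrite !in_itv/= => /andP[? _] /andP[_ ?] /andP[? ?]; lra.
  have dst z : z \in `]s, t[ -> is_derive z 1 g (g' z).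
    move=> zI; apply/dg/sub; apply: subset_itv_oo_cc zI.
  have cst : {within `[s, t], continuous g}.
    by apply: derivable_within_continuous => z /sub zI; have [] := dg z zI.
  have [c cI E] := MVT_segment st dst cst.
  by exists c => //; rewrite sub// andbT; move: cI; rewrite in_itv.
move=> hx hy; have [yx|/ltW xy] := leP y x.
  have [c /andP[/andP[? ?] cI] E] := mvt _ _ yx hy hx.
  by exists c; split => //; rewrite !ger0_norm; lra.
have [c /andP[/andP[? ?] cI] E] := mvt _ _ xy hx hy.
by exists c; split => //; [rewrite !ler0_norm; lra | rewrite -opprB E; ring].
Qed.

Lemma MVT_lipschitz g (g' : R -> R) u v M x y :
  (forall z, z \in `]u, v[ -> is_derive z 1 g (g' z)) ->
  (forall z, z \in `]u, v[ -> `|g' z| <= M) ->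
  x \in `]u, v[ -> y \in `]u, v[ -> `|g x - g y| <= M * `|x - y|.
Proof.
move=> dg gM hx hy; have [c [cI _ ->]] := MVT_between dg hx hy.
by rewrite normrM ler_wpM2r// gM.
Qed.

(** The mean value theorem is used twice: [g x] equals [g1 c * (x - x0)], and [g1 c] is at most [M]
    times the distance from [c] to [x0]. *)
Lemma taylor2_bound g (g1 g2 : R -> R) u v M x0 x :
  (forall z, z \in `]u, v[ -> is_derive z 1 g (g1 z)) ->
  (forall z, z \in `]u, v[ -> is_derive z 1 g1 (g2 z)) ->
  (forall z, z \in `]u, v[ -> `|g2 z| <= M) ->
  x0 \in `]u, v[ -> x \in `]u, v[ -> g x0 = 0 -> g1 x0 = 0 ->
  `|g x| <= M * (x - x0) ^+ 2.
Proof.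
move=> dg dg1 g2M hx0 hx g0 g10.
have [c [cI cx]] := MVT_between dg hx hx0; rewrite g0 subr0 => ->.
have := MVT_lipschitz dg1 g2M cI hx0; rewrite g10 subr0 => h.
have M0 : 0 <= M by apply: le_trans (g2M _ hx0).
rewrite normrM -(normr_id (x - x0)) -real_normK ?num_real// expr2 mulrA normr_id.
by rewrite ler_wpM2r// (le_trans h)// ler_wpM2l.
Qed.

Lemma is_derive_shift g (d : R) x a :
  is_derive (x - a) 1 g d -> is_derive x 1 (fun y => g (y - a)) d.
Proof.
move=> [dg gd].
have E : (fun h : R => h^-1 *: (((fun y => g (y - a)) \o shift x) (h *: 1) - g (x - a))) =
    (fun h : R => h^-1 *: ((g \o shift (x - a)) (h *: 1) - g (x - a))).
  by apply/funext => h /=; rewrite addrA.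
by split; [rewrite /derivable E | rewrite /derive E].
Qed.

(** At an interior point every small enough increment stays in [[0, 1]], so the relative limit is
    the two-sided one. *)
Lemma deriv01_is_derive g (g' : R -> R) x : deriv01 g g' -> x \in `]0, 1[ ->
  is_derive x 1 g (g' x).
Proof.
move=> dg; rewrite in_itv/= => /andP[x0 x1].
have /dg h : x \in `[0, 1] by rewrite in_itv/= !ltW.
have {}h : (fun h : R => h^-1 *: ((g \o shift x) (h *: 1) - g x)) @ 0^' --> g' x.
  have -> : (fun h : R => h^-1 *: ((g \o shift x) (h *: 1) - g x)) =
      (fun h : R => h^-1 * (g (x + h) - g x)).
    by apply/funext => k /=; rewrite [k *: 1]mulr1 [k + x]addrC.
  apply: cvg_trans h; apply: cvg_app => A; rewrite /within/= => hA.
  have hI : \forall k \near (0 : R), x + k \in `[0, 1].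
    have e0 : 0 < Num.min x (1 - x) by rewrite lt_min x0 subr_gt0.
    apply/nbhs_ballP; exists (Num.min x (1 - x)) => //= k.
    by rewrite /ball/= sub0r normrN lt_min !ltr_norml in_itv/=; lra.
  suff : \forall k \near (0 : R), k != 0 -> A k by [].
  have hA' : \forall k \near (0 : R), k != 0 /\ x + k \in `[0, 1] -> A k := hA.
  near=> k => k0; have kI : x + k \in `[0, 1] by near: k.
  by move: (conj k0 kI); near: k.
by split; [apply/cvg_ex; exists (g' x) | apply: cvg_lim].
Unshelve. all: by end_near.
Qed.

Lemma le_norm_sin_sub x y : `|sin x - sin y| <= `|x - y|.
Proof.
rewrite -[leRHS]mul1r.
have [b xb yb] : exists2 b, x \in `](- b), b[ & y \in `](- b), b[.
  have := normr_ge0 x; have := normr_ge0 y.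
  by exists (`|x| + `|y| + 1); rewrite in_itv/= -ltr_norml; lra.
by apply: (@MVT_lipschitz _ cos (- b) b) => // z _; exact: cos_max.
Qed.

End Calculus.

(** * The slowly oscillating sequence of tangency abscissas *)

Section Oscillation.
Context {R : realType}.

(* A sequence whose n-th step is O(1/n), but which still sweeps across the whole
   window [2/5, 3/5] within every range of indices [L, C L]. *)
Definition osc (n : nat) : R := 1 / 2 + sin (ln n%:R) / 10.

Lemma osc_itv n : osc n \in `[2 / 5, 3 / 5].
Proof.
have := sin_geN1 (ln n%:R : R); have := sin_le1 (ln n%:R : R).
by rewrite in_itv/= /osc; lra.
Qed.

(** The sine is 1-Lipschitz, and consecutive logarithms differ by [ln (1 + 1/n)], at most [1/n]. *)
Lemma osc_step n : (0 < n)%N -> `|osc n.+1 - osc n| <= n%:R^-1.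
Proof.
move=> n0; have n0R : 0 < n%:R :> R by rewrite ltr0n.
have V0 : 0 < n%:R^-1 :> R by rewrite invr_gt0.
have -> : osc n.+1 - osc n = (sin (ln n.+1%:R) - sin (ln n%:R)) / 10.
  by rewrite /osc; field.
have E : n.+1%:R = n%:R * (1 + n%:R^-1) :> R.
  by rewrite mulrDr mulr1 divff ?gt_eqF// -natr1.
have l0 : 0 <= ln (1 + n%:R^-1) :> R by apply: ln_ge0; lra.
have l1 : ln (1 + n%:R^-1) <= n%:R^-1 :> R by apply: le_ln1Dx; lra.
have := le_norm_sin_sub (ln n.+1%:R : R) (ln n%:R).
rewrite E lnM ?posrE ?addr_gt0//.
rewrite addrAC subrr add0r (ger0_norm l0) normrM (@ger0_norm _ 10^-1); last lra.
by lra.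
Qed.

(** By periodicity of the sine, [x = 1/2 + sin t / 10] has a solution [t] within a bounded distance
    above [ln L]; the integer part [n] of [expR t] then has [ln n] within [1/n] of [t]. *)
Lemma osc_dense : exists2 C : R, 1 <= C & forall x L : R, x \in `[2 / 5, 3 / 5] ->
  1 <= L -> exists n : nat, [/\ (0 < n)%N, L <= n%:R <= C * L & `|x - osc n| <= n%:R^-1].
Proof.
have pi0 : 0 < pi :> R := pi_gt0 R.
exists (expR (1 + pi * 5)) => [|x L xI L1]; first by apply: le_trans (expR_ge1Dx _); lra.
pose y := 10 * (x - 1 / 2).
have yI : -1 <= y <= 1 by move: xI; rewrite in_itv/= /y; lra.
pose th := asin y.
have thE : sin th = y by rewrite asinK// in_itv.
have th1 : - (pi / 2) <= th by exact: asin_geNpi2.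
have th2 : th <= pi / 2 by exact: asin_lepi2.
have lL : 0 <= ln L by apply: ln_ge0.
(* The number of periods to add to [th]. The term [pi / 2] makes [z] nonnegative, as truncation
   requires. *)
pose z := (ln L + 1 + pi / 2 - th) / (2 * pi).
have z0 : 0 <= z by rewrite divr_ge0; lra.
have [k k1 k2] : exists2 k : nat, z <= k%:R & k%:R <= z + 1.
  have /andP[h1 h2] := truncn_itv z0.
  by exists (Num.truncn z).+1; [exact: ltW | rewrite -natr1; lra].
pose t := th + (pi *+ 2) *+ k.
have tE : t = th + 2 * pi * k%:R by rewrite /t -[_ *+ k]mulr_natr -[pi *+ 2]mulr_natl.
have [t1 t2] : ln L + 1 <= t /\ t <= ln L + (1 + pi * 5).
  have zE : z * (2 * pi) = ln L + 1 + pi / 2 - th by rewrite /z divfK// gt_eqF//; lra.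
  have h1 : z * (2 * pi) <= k%:R * (2 * pi) by rewrite ler_pM2r//; lra.
  have h2 : k%:R * (2 * pi) <= (z + 1) * (2 * pi) by rewrite ler_pM2r//; lra.
  by rewrite tE; split; lra.
have L0 : 0 < L by lra.
have eL : L * expR 1 <= expR t.
  by rewrite -[X in X * _]lnK ?posrE// -expRD ler_expR.
have eU : expR t <= expR (1 + pi * 5) * L.
  by rewrite -[X in _ * X]lnK ?posrE// -expRD ler_expR; lra.
(* The extra unit in [ln L + 1 <= t] gives [expR t >= 2 * L], so the integer part of [expR t] is
   still at least [L]. *)
have e2 : 2 <= expR 1 :> R by have := @expR_ge1Dx R 1; lra.
have eL2 : 2 * L <= expR t by apply: le_trans eL; rewrite mulrC ler_wpM2l//; lra.
pose n := Num.truncn (expR t).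
have /andP[n1 n2] := truncn_itv (expR_ge0 t).
have nE : (Num.truncn (expR t)).+1%:R = n%:R + 1 :> R by rewrite -natr1.
have Ln : L <= n%:R by move: n2; rewrite nE; lra.
have n0 : 0 < n%:R :> R by lra.
exists n; split; [by rewrite -(ltr0n R) | by rewrite Ln (le_trans n1) |].
have V0 : 0 < n%:R^-1 :> R by rewrite invr_gt0.
have xE : x = 1 / 2 + sin t / 10.
  by rewrite /t (periodicn (@sinD2pi R)) thE /y; field.
have -> : x - osc n = (sin t - sin (ln n%:R)) / 10 by rewrite xE /osc; field.
have := le_norm_sin_sub t (ln n%:R).
(* The difference is the logarithm of [expR t / n], a ratio between 1 and [1 + 1/n]. *)
have h : 0 <= t - ln n%:R <= n%:R^-1.
  rewrite -[X in X - _]expRK -ln_div ?posrE ?expR_gt0//.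
  have -> : expR t / n%:R = 1 + (expR t / n%:R - 1) by ring.
  have q1 : 1 <= expR t / n%:R by rewrite ler_pdivlMr// mul1r.
  have q2 : expR t / n%:R <= 1 + n%:R^-1.
    rewrite ler_pdivrMr// mulrDl mul1r mulVf ?gt_eqF//; lra.
  rewrite ln_ge0; last by lra.
  by apply: (le_trans (le_ln1Dx _)); lra.
rewrite [X in _ <= X]ger0_norm; last by case/andP: h.
by rewrite normrM (@ger0_norm _ 10^-1); lra.
Qed.

End Oscillation.

(** * Changing the parameter while keeping tangency at a prescribed abscissa *)

Section TangentStep.
Context {R : realType}.

Definition dilate (f : R -> R) (a xi eta x : R) : R := a * f (x - xi) + eta.

Lemma is_derive_dilate f (d a xi eta x : R) :
  is_derive (x - xi) 1 f d -> is_derive x 1 (dilate f a xi eta) (a * d).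
Proof.
move=> /is_derive_shift df.
have -> : dilate f a xi eta = a *: (fun y => f (y - xi)) + cst eta by [].
by apply: is_derive_eq; rewrite addr0.
Qed.

Context (f f1 f2 f3 : R -> R) (m M : R).
Context (df : forall x : R, x \in `]0, 1[ -> is_derive x 1 f (f1 x))
  (df1 : forall x : R, x \in `]0, 1[ -> is_derive x 1 f1 (f2 x))
  (df2 : forall x : R, x \in `]0, 1[ -> is_derive x 1 f2 (f3 x)).
Context (m0 : 0 < m) (fM : forall x : R, x \in `]0, 1[ -> `|f x| <= M)
  (f1M : forall x : R, x \in `]0, 1[ -> `|f1 x| <= M)
  (f2m : forall x : R, x \in `]0, 1[ -> m <= f2 x)
  (f2M : forall x : R, x \in `]0, 1[ -> `|f2 x| <= M)
  (f3M : forall x : R, x \in `]0, 1[ -> `|f3 x| <= M).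

(** The first term bounds the horizontal shift per unit of [h]. The other two bound the change of
    [a * k (z - xi)], for [k] a derivative of [f]: [M] from the change of [a], the last from the
    shift, using [a <= 2]. *)
Definition step_cst : R := M / m + M + 2 * M * (M / m).

Let M_ge0 : 0 <= M.
Proof.
have h : (1 / 2 : R) \in `]0, 1[ by rewrite in_itv/=; lra.
exact: le_trans (normr_ge0 _) (fM h).
Qed.

Lemma step_cst_ge0 : 0 <= step_cst.
Proof.
have : 0 <= M / m by rewrite divr_ge0// ltW.
move=> h; have := mulr_ge0 M_ge0 h; have := M_ge0.
by rewrite /step_cst; lra.
Qed.

(** The slope to reach differs from [f1 s] by at most [M * h], while [f1] changes by at least
    [m / 10] over a distance [1 / 10] on either side, since [f2 >= m]. The intermediate value
    theorem gives [s'], and the same lower bound on [f2] controls its distance to [s]. *)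
Lemma tangency_point (a h s : R) : 1 <= a -> 0 <= h -> M * h <= m / 10 ->
  s \in `[1 / 5, 4 / 5] ->
  exists s' : R, [/\ s' \in `[s - 1 / 10, s + 1 / 10], `|s' - s| <= M / m * h &
    (a + h) * f1 s' = a * f1 s].
Proof.
move=> a1 h0 hm; rewrite in_itv/= => /andP[s1 s2].
have sub z : z \in `[s - 1 / 10, s + 1 / 10] -> z \in `]0, 1[.
  by rewrite !in_itv/=; lra.
have sI : s \in `]0, 1[ by apply: sub; rewrite in_itv/=; lra.
have lI : s - 1 / 10 \in `]0, 1[ by apply: sub; rewrite in_itv/=; lra.
have rI : s + 1 / 10 \in `]0, 1[ by apply: sub; rewrite in_itv/=; lra.
have ah : 0 < a + h by lra.
pose w := a / (a + h) * f1 s.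
have wE : f1 s - w = f1 s * h / (a + h) by rewrite /w; field; rewrite gt_eqF.
have wB : `|f1 s - w| <= M * h.
  rewrite wE normrM normrM (ger0_norm h0) (@ger0_norm _ (a + h)^-1) ?invr_ge0 ?(ltW ah)//.
  rewrite -mulrA; apply: ler_pM; rewrite ?mulr_ge0 ?invr_ge0 ?(ltW ah) ?f1M//.
  by rewrite ler_pdivrMr// ler_peMr//; lra.
have fl : f1 (s - 1 / 10) <= f1 s - m / 10.
  have [c [cI _ E]] := MVT_between df1 sI lI.
  by have := f2m cI; lra.
have fr : f1 s + m / 10 <= f1 (s + 1 / 10).
  have [c [cI _ E]] := MVT_between df1 rI sI.
  by have := f2m cI; lra.
have lr : s - 1 / 10 <= s + 1 / 10 by lra.
have cf1 : {within `[s - 1 / 10, s + 1 / 10], continuous f1}.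
  by apply: derivable_within_continuous => z /sub zI; have [] := df1 zI.
have wI : Num.min (f1 (s - 1 / 10)) (f1 (s + 1 / 10)) <= w <=
    Num.max (f1 (s - 1 / 10)) (f1 (s + 1 / 10)).
  by move: wB; rewrite ler_norml ge_min le_max; lra.
have [s' s'I s'E] := IVT lr cf1 wI.
exists s'; split => //; last first.
  by rewrite s'E /w mulrA [_ * (a / _)]mulrC divfK// gt_eqF.
have [c [cI _ E]] := MVT_between df1 (sub _ s'I) sI.
move: wB; rewrite -s'E distrC E normrM (ger0_norm (le_trans (ltW m0) (f2m cI))) => wB.
rewrite mulrAC ler_pdivlMr// mulrC; apply: le_trans wB.
by rewrite ler_wpM2r// f2m.
Qed.

(** The difference of the two curves vanishes at [x0] together with its derivative, and its second
    derivative is of order [h] because [f2] is bounded and Lipschitz. *)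
Lemma tangent_step (a h xi eta x0 : R) : 1 <= a <= 2 -> 0 <= h -> M * h <= m / 10 ->
  xi \in `[- (1 / 5), 1 / 5] -> x0 \in `[2 / 5, 3 / 5] ->
  exists xi' eta' : R, [/\ `|xi' - xi| <= step_cst * h, `|eta' - eta| <= step_cst * h &
    forall x : R, x \in `[2 / 5, 3 / 5] ->
      `|dilate f (a + h) xi' eta' x - dilate f a xi eta x| <=
        step_cst * h * (x - x0) ^+ 2].
Proof.
move=> /andP[a1 a2] h0 hm; rewrite !in_itv/= => /andP[xi1 xi2] /andP[x01 x02].
have [|s' [s'I s's tg]] := @tangency_point a h (x0 - xi) a1 h0 hm.
  by rewrite in_itv/=; lra.
have Mm0 : 0 <= M / m by rewrite divr_ge0// ltW.
have Mmh : 0 <= M / m * h by rewrite mulr_ge0.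
have MMmh : 0 <= M * (M / m * h) by rewrite mulr_ge0.
have Mh : 0 <= M * h by rewrite mulr_ge0.
have BE : step_cst * h = M / m * h + M * h + 2 * (M * (M / m * h)).
  by rewrite /step_cst; ring.
have s'I1 : s' \in `]0, 1[ by move: s'I; rewrite !in_itv/=; lra.
have sI1 : x0 - xi \in `]0, 1[ by rewrite in_itv/=; lra.
(* [xi'] brings the point of matching slope above [x0]; [eta'] then makes the curves meet there. *)
pose xi' := x0 - s'; pose eta' := eta + a * f (x0 - xi) - (a + h) * f s'.
have xiE : xi' - xi = - (s' - (x0 - xi)) by rewrite /xi'; ring.
have xi'2 : `|xi' - xi| <= M / m * h by rewrite xiE normrN.
(* Applied to [k = f] for the vertical shift, and to [k = f2] for the second derivative of the
   difference. *)
have combine (k k' : R -> R) z : (forall y : R, y \in `]0, 1[ -> is_derive y 1 k (k' y)) ->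
    (forall y : R, y \in `]0, 1[ -> `|k y| <= M) -> (forall y : R, y \in `]0, 1[ -> `|k' y| <= M) ->
    z - xi' \in `]0, 1[ -> z - xi \in `]0, 1[ ->
    `|(a + h) * k (z - xi') - a * k (z - xi)| <= M * h + 2 * (M * (M / m * h)).
  move=> dk kM k'M z1 z2.
  have -> : (a + h) * k (z - xi') - a * k (z - xi) =
      h * k (z - xi') + a * (k (z - xi') - k (z - xi)) by ring.
  apply: le_trans (ler_normD _ _) _; rewrite !normrM (ger0_norm h0) (@ger0_norm _ a); last lra.
  apply: lerD; first by rewrite mulrC ler_wpM2r// kM.
  apply: ler_pM => //; first lra.
  apply: le_trans (MVT_lipschitz dk k'M z1 z2) _.
  rewrite ler_wpM2l//.
  have -> : z - xi' - (z - xi) = - (xi' - xi) by ring.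
  by rewrite normrN.
have x0E : x0 - xi' = s' by rewrite /xi'; ring.
exists xi', eta'; split.
- by rewrite BE; lra.
- have -> : eta' - eta = - ((a + h) * f (x0 - xi') - a * f (x0 - xi)).
    by rewrite x0E /eta'; ring.
  rewrite normrN BE.
  have := @combine f f1 x0 df fM f1M; rewrite x0E => /(_ s'I1 sI1); lra.
move=> x; rewrite in_itv/= => /andP[x1 x2].
(* The margin [3 / 10] is the sum of the bound [1 / 5] on [xi] and the bound [1 / 10] on the
   displacement of the tangency point. *)
have subI z : z \in `](3 / 10), (7 / 10)[ -> (z - xi' \in `]0, 1[) /\ (z - xi \in `]0, 1[).
  by move: s'I; rewrite !in_itv/= /xi'; lra.
pose g1 z := (a + h) * f1 (z - xi') - a * f1 (z - xi).
pose g2 z := (a + h) * f2 (z - xi') - a * f2 (z - xi).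
pose g : R -> R := dilate f (a + h) xi' eta' - dilate f a xi eta.
have dg (z : R) : z \in `](3 / 10), (7 / 10)[ -> is_derive z 1 g (g1 z).
  move=> /subI[z1 z2].
  have d1 := is_derive_dilate (a + h) eta' (df z1).
  have d2 := is_derive_dilate a eta (df z2).
  exact: is_deriveB.
have dg1 (z : R) : z \in `](3 / 10), (7 / 10)[ -> is_derive z 1 g1 (g2 z).
  move=> /subI[z1 z2].
  have d1 := is_derive_dilate (a + h) 0 (df1 z1).
  have d2 := is_derive_dilate a 0 (df1 z2).
  have -> : g1 = dilate f1 (a + h) xi' 0 - dilate f1 a xi 0.
    by apply/funext => y; rewrite /g1 /dilate/= !fctE !addr0.
  exact: is_deriveB.
have g2B (z : R) : z \in `](3 / 10), (7 / 10)[ -> `|g2 z| <= step_cst * h.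
  move=> /subI[z1 z2]; rewrite BE.
  by apply: le_trans (combine _ _ _ df2 f2M f3M z1 z2) _; lra.
have x0I : x0 \in `](3 / 10), (7 / 10)[ by rewrite in_itv/=; lra.
have xI : x \in `](3 / 10), (7 / 10)[ by rewrite in_itv/=; lra.
have g0 : g x0 = 0 by rewrite /g !fctE /dilate x0E /eta'; ring.
have g10 : g1 x0 = 0 by rewrite /g1 x0E tg subrr.
exact: (taylor2_bound dg dg1 g2B x0I xI g0 g10).
Qed.

End TangentStep.

(** * The binary tree of curves and the compact set it defines *)

Section Tree.
Context {R : realType}.

Definition wt (n : nat) : R := 2^-1 ^+ n.

Lemma wt_gt0 n : 0 < wt n.
Proof. by rewrite exprn_gt0// invr_gt0. Qed.

Lemma wtS n : wt n.+1 = wt n / 2.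
Proof. by rewrite /wt exprS mulrC. Qed.

Lemma natX2_wt n : (2 ^ n)%:R * wt n = 1.
Proof. by rewrite natrX -exprMn mulfV ?expr1n// pnatr_eq0. Qed.

Lemma wt_le (n k : nat) : (k <= n)%N -> wt n <= wt k.
Proof. by move=> kn; apply: ler_wiXn2l => //; lra. Qed.

Lemma cvgn_geometric_steps (u : nat -> R) (C : R) :
  (forall n, `|u n.+1 - u n| <= C * wt n) -> cvgn u.
Proof.
move=> uC.
have C0 : 0 <= C by have := le_trans (normr_ge0 _) (uC 0%N); rewrite /wt expr0 mulr1.
have h : cvgn (series (telescope u)).
  apply: normed_cvg; apply: (@series_le_cvg _ _ (geometric C 2^-1)) => [n|n|n|].
  - exact: normr_ge0.
  - by rewrite /geometric/= mulr_ge0// exprn_ge0.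
  - exact: uC.
  - by apply: is_cvg_geometric_series; rewrite ger0_norm; lra.
have -> : u = cst (u 0%N) + series (telescope u).
  by apply/funext => n; rewrite [LHS]eq_sum_telescope.
by apply: is_cvgD => //; exact: is_cvg_cst.
Qed.

Context (f : R -> R) (B M : R) (k0 : nat) (step : R -> R -> R * R -> R -> R * R).
Context (fc : forall x : R, x \in `]0, 1[ -> {for x, continuous f})
  (fM : forall x : R, x \in `]0, 1[ -> `|f x| <= M)
  (B0 : 0 <= B) (k0_gt0 : (0 < k0)%N) (Bk0 : B * wt k0 <= 1 / 5).
Context (stepP : forall (a h : R) (p : R * R) (x0 : R),
  1 <= a <= 2 -> 0 <= h <= wt k0 -> p.1 \in `[- (1 / 5), 1 / 5] ->
  x0 \in `[2 / 5, 3 / 5] ->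
  [/\ `|(step a h p x0).1 - p.1| <= B * h, `|(step a h p x0).2 - p.2| <= B * h &
    forall x : R, x \in `[2 / 5, 3 / 5] ->
      `|dilate f (a + h) (step a h p x0).1 (step a h p x0).2 x - dilate f a p.1 p.2 x| <=
        B * h * (x - x0) ^+ 2]).

(* The node [(j, i)] carries the translation of the curve with parameter
   [a = i / 2 ^ (k0 + j)]; its parent drops the last binary digit of [a]. *)
Fixpoint node (j i : nat) : R * R :=
  if j is j'.+1 then
    step (i./2%:R * wt (k0 + j')) ((odd i)%:R * wt (k0 + j').+1)
      (node j' i./2) (osc (k0 + j').+1)
  else (0, 0).

Definition branch (j i : nat) (x : R) : R :=
  dilate f (i%:R * wt (k0 + j)) (node j i).1 (node j i).2 x.

(** These are the indices whose parameter lies in [[1, 2]]. The upper end is included so that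
    [a = 2] has a branch; level 0 thus has [2 ^ k0 + 1] roots, all untranslated. *)
Definition valid (j i : nat) : bool := (2 ^ (k0 + j) <= i <= 2 ^ (k0 + j).+1)%N.

Lemma valid_half j i : valid j.+1 i -> valid j i./2.
Proof.
rewrite /valid addnS => /andP[h1 h2]; apply/andP; split.
  by rewrite -(doubleK (2 ^ _)%N) half_leq// -mul2n -expnS.
by rewrite -(doubleK (2 ^ _)%N) half_leq// -mul2n -expnS.
Qed.

Lemma valid_param j i : valid j i -> 1 <= i%:R * wt (k0 + j) <= 2.
Proof.
move=> /andP[h1 h2]; have w0 := wt_gt0 (k0 + j).
rewrite -{1}(natX2_wt (k0 + j)) ler_wpM2r ?ler_nat ?(ltW w0)//=.
have -> : 2 = (2 ^ (k0 + j).+1)%:R * wt (k0 + j) :> R.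
  by rewrite expnS natrM -mulrA natX2_wt mulr1.
by rewrite ler_wpM2r ?ler_nat ?(ltW w0).
Qed.

Lemma param_step j i :
  i%:R * wt (k0 + j).+1 = i./2%:R * wt (k0 + j) + (odd i)%:R * wt (k0 + j).+1 :> R.
Proof. by rewrite -{1}(odd_double_half i) natrD -muln2 natrM wtS; field. Qed.

(** The shift at each level is at most [B] times the drop of [wt], so the sum telescopes. With [Bk0]
    the induction hypothesis also supplies the range condition on the translation that [stepP]
    demands. *)
Lemma node_norm_le j i : valid j i ->
  `|(node j i).1| <= B * (wt k0 - wt (k0 + j)).
Proof.
elim: j i => [|j IH] i vi /=; first by rewrite addn0 subrr mulr0 normr0.
have vh := valid_half vi; have := IH _ vh => IHi.
have w0 := wt_gt0 (k0 + j); have wS := wtS (k0 + j).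
have hB : 0 <= (odd i)%:R * wt (k0 + j).+1 <= wt (k0 + j).+1.
  by case: (odd i); rewrite ?mul0r ?mul1r; lra.
have hk : wt (k0 + j).+1 <= wt k0 by apply: wt_le; rewrite -addnS leq_addr.
have hI : (node j i./2).1 \in `[- (1 / 5), 1 / 5].
  rewrite in_itv/= -ler_norml (le_trans IHi)// (le_trans _ Bk0)// ler_wpM2l//; lra.
have hh : 0 <= (odd i)%:R * wt (k0 + j).+1 <= wt k0 by lra.
have [s1 _ _] := stepP (valid_param vh) hh hI (osc_itv (k0 + j).+1).
rewrite addnS; set p := step _ _ _ _ in s1 *.
have -> : p.1 = (p.1 - (node j i./2).1) + (node j i./2).1 by ring.
apply: le_trans (ler_normD _ _) _; apply: le_trans (lerD s1 IHi) _.
by rewrite -mulrDr ler_wpM2l//; lra.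
Qed.

Lemma node_itv j i : valid j i -> (node j i).1 \in `[- (1 / 5), 1 / 5].
Proof.
move=> /node_norm_le h; rewrite in_itv/= -ler_norml (le_trans h)// (le_trans _ Bk0)//.
by rewrite ler_wpM2l// gerBl ltW// wt_gt0.
Qed.

(** The increment of the parameter is 0 or [wt (k0 + j).+1] according to the new digit; the bounds
    are stated for the larger value. *)
Lemma node_step j i : valid j.+1 i ->
  [/\ `|(node j.+1 i).1 - (node j i./2).1| <= B * wt (k0 + j).+1,
      `|(node j.+1 i).2 - (node j i./2).2| <= B * wt (k0 + j).+1 &
    forall x : R, x \in `[2 / 5, 3 / 5] ->
      `|branch j.+1 i x - branch j i./2 x| <=
        B * wt (k0 + j).+1 * (x - osc (k0 + j).+1) ^+ 2].
Proof.
move=> vi; have vh := valid_half vi.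
have w0 := wt_gt0 (k0 + j); have wS := wtS (k0 + j).
have hB : 0 <= (odd i)%:R * wt (k0 + j).+1 <= wt (k0 + j).+1.
  by case: (odd i); rewrite ?mul0r ?mul1r; lra.
have hk : wt (k0 + j).+1 <= wt k0 by apply: wt_le; rewrite -addnS leq_addr.
have hh : 0 <= (odd i)%:R * wt (k0 + j).+1 <= wt k0 by lra.
have [s1 s2 s3] := stepP (valid_param vh) hh (node_itv vh) (osc_itv (k0 + j).+1).
have hw : B * ((odd i)%:R * wt (k0 + j).+1) <= B * wt (k0 + j).+1.
  by rewrite ler_wpM2l//; case/andP: hB.
split; [exact: le_trans s1 hw | exact: le_trans s2 hw |] => x xI.
have := s3 x xI; rewrite -param_step /branch addnS => /le_trans; apply.
by rewrite ler_wpM2r// sqr_ge0.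
Qed.

(** Half-width at [x] of a neighbourhood of a level-[j] branch that holds all its descendants. The
    constants 2 and 6 are those with which the induction in [rad_step] closes. *)
Definition rad (j : nat) (x : R) : R :=
  2 * B * wt (k0 + j) * ((x - osc (k0 + j)) ^+ 2 + 6 * (k0 + j)%:R ^- 2).

Lemma rad_ge0 j x : 0 <= rad j x.
Proof.
by rewrite /rad mulr_ge0 ?addr_ge0 ?sqr_ge0 ?mulr_ge0 ?(ltW (wt_gt0 _))// invr_ge0 exprn_ge0.
Qed.

Lemma rad_step j x :
  B * wt (k0 + j).+1 * (x - osc (k0 + j).+1) ^+ 2 + rad j.+1 x <= rad j x.
Proof.
rewrite /rad addnS wtS; set n := (k0 + j)%N; set w := wt n.
have n0 : (0 < n)%N by rewrite addn_gt0 k0_gt0.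
have nR : 0 < n%:R :> R by rewrite ltr0n.
have : `|osc n.+1 - osc n| <= n%:R^-1 :> R := osc_step n0.
set e := osc n.+1 - osc n => he; set d := x - osc n.
have -> : x - osc n.+1 = d - e by rewrite /d /e; ring.
have e2 : e ^+ 2 <= n%:R ^- 2.
  rewrite -real_normK ?num_real// -exprVn.
  by apply: lerXn2r; rewrite // nnegrE ?invr_ge0 ?(ltW nR).
have n2 : n.+1%:R ^- 2 <= n%:R ^- 2 :> R.
  by rewrite lef_pV2 ?posrE ?exprn_gt0 ?ltr0n// lerXn2r ?nnegrE// ler_nat.
(* In [key] below, the right side minus the left is [9/2 * (d/3 + e)^2 + 12/n^2 - 6 * e^2 -
   6/(n+1)^2], and both [e^2] and [1/(n+1)^2] are at most [1/n^2]. *)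
have de : 0 <= (d / 3 + e) ^+ 2 by exact: sqr_ge0.
have Bw : 0 <= B * w by rewrite mulr_ge0// ltW// wt_gt0.
have key : 3 / 2 * (d - e) ^+ 2 + 6 * n.+1%:R ^- 2 <= 2 * d ^+ 2 + 12 * n%:R ^- 2.
  move: e2 n2 de; set X := n%:R ^- 2; set Y := n.+1%:R ^- 2 => e2 n2 de; lra.
have := ler_wpM2l Bw key; move: key Bw; rewrite -/n.
set X := n%:R ^- 2; set Y := n.+1%:R ^- 2 => _ _ h.
have -> : B * (w / 2) * (d - e) ^+ 2 + 2 * B * (w / 2) * ((d - e) ^+ 2 + 6 * Y) =
  B * w * (3 / 2 * (d - e) ^+ 2 + 6 * Y) by field.
by apply: le_trans h _; rewrite le_eqVlt; apply/orP; left; apply/eqP; ring.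
Qed.

(** An intersection over levels of finite unions of strips, rather than the union of the limit
    curves: closedness and the covering of vertical sections can be read off level by level. *)
Definition stripK : set (R * R) :=
  [set z | z.1 \in `[2 / 5, 3 / 5] /\
     forall j, exists2 i, valid j i & `|z.2 - branch j i z.1| <= rad j z.1].

Lemma dilate_continuous (a xi eta x : R) : x - xi \in `]0, 1[ ->
  {for x, continuous (dilate f a xi eta)}.
Proof.
move=> /fc cf.
have h : (fun y => f (y - xi)) @ x --> f (x - xi).
  apply: (@cvg_comp _ _ _ (fun y => y - xi) f _ (nbhs (x - xi))) => //.
  by apply: cvgB => //; exact: cvg_cst.
by apply: cvgD; [apply: cvgM => //; exact: cvg_cst | exact: cvg_cst].
Qed.

Lemma sub_node_itv j i (x : R) : valid j i -> x \in `[2 / 5, 3 / 5] ->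
  x - (node j i).1 \in `]0, 1[.
Proof. by move=> /node_itv; rewrite !in_itv/=; lra. Qed.

(** Continuity is asked only at points of [D], because a branch is known to be continuous only above
    the window. *)
Lemma closed_sublevel (T : topologicalType) (D : set T) (phi : T -> R) :
  closed D -> (forall p, D p -> {for p, continuous phi}) ->
  closed [set p | D p /\ phi p <= 0].
Proof.
move=> cD cphi p clp.
have Dp : D p.
  by apply: cD => U /clp[q [[Dq _] Uq]]; exists q.
split=> //; rewrite leNgt; apply/negP => phip.
have h : phi @ p --> phi p := cphi p Dp.
have : nbhs p [set q | 0 < phi q] by exact: (cvgr_gt _ h _ phip).
by move=> /clp[q [[_ q1] /=]]; rewrite ltNge q1.
Qed.

Lemma rad_continuous j : continuous (rad j).
Proof.
move=> x.
have h : (fun y : R => y - osc (k0 + j)) @ x --> x - osc (k0 + j).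
  by apply: cvgB => //; exact: cvg_cst.
have h2 : (fun y : R => (y - osc (k0 + j)) ^+ 2) @ x --> (x - osc (k0 + j)) ^+ 2.
  exact: (cvgM h h).
exact: (cvgM (cvg_cst _) (cvgD h2 (cvg_cst _))).
Qed.

(** Each level has finitely many valid indices, so its union of closed strips is closed. *)
Lemma stripK_closed : closed stripK.
Proof.
pose S j i : set (R * R) := [set z | z.1 \in `[2 / 5, 3 / 5] /\
  `|z.2 - branch j i z.1| - rad j z.1 <= 0].
have -> : stripK = [set z | z.1 \in `[2 / 5, 3 / 5]] `&`
    \bigcap_j \bigcup_(i in [set i | valid j i]) S j i.
  apply/seteqP; split=> [z [zI zj]|z [/= zI zj]].
    split=> // j _; have [i vi h] := zj j.
    by exists i => //; split => //; rewrite subr_le0.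
  split=> // j; have [i vi [_ h]] := zj j I.
  by exists i => //; rewrite -subr_le0.
have cI : closed [set z : R * R | z.1 \in `[2 / 5, 3 / 5]].
  apply: (@closed_comp _ _ (fst : R * R -> R) [set` `[2 / 5, 3 / 5]]).
    by move=> z _; exact: cvg_fst.
  exact: itv_closed.
apply: closedI => //; apply: closed_bigI => j _; apply: closed_bigcup.
  apply: (@sub_finite_set _ _ `I_(2 ^ (k0 + j).+1).+1); last exact: finite_II.
  by move=> i /= /andP[].
move=> i vi; apply: closed_sublevel => // z zI.
have hb : (fun y : R * R => branch j i y.1) @ z --> branch j i z.1.
  apply: (@cvg_comp _ _ _ (fst : R * R -> R) (branch j i) _ (nbhs z.1)); first exact: cvg_fst.
  exact/dilate_continuous/sub_node_itv.
have hr : (fun y : R * R => rad j y.1) @ z --> rad j z.1.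
  apply: (@cvg_comp _ _ _ (fst : R * R -> R) (rad j) _ (nbhs z.1)); first exact: cvg_fst.
  exact: rad_continuous.
have hs : (fun y : R * R => y.2) @ z --> z.2 by exact: cvg_snd.
exact: (cvgB (cvg_norm (cvgB hs hb)) hr).
Qed.

Lemma rad0_le (x : R) : x \in `[2 / 5, 3 / 5] -> rad 0 x <= 7.
Proof.
rewrite /rad addn0 => xI; have w0 := wt_gt0 k0.
have oI := osc_itv (R := R) k0.
have h1 : (x - osc k0) ^+ 2 <= 1 / 25.
  rewrite -real_normK ?num_real//.
  have -> : 1 / 25 = (1 / 5) ^+ 2 :> R by field.
  apply: lerXn2r; rewrite ?nnegrE ?divr_ge0//.
  by move: xI oI; rewrite !in_itv/= ler_norml; lra.
have h2 : k0%:R ^- 2 <= 1 :> R.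
  by rewrite invf_le1 ?exprn_gt0 ?ltr0n// exprn_ege1// ler1n.
have h3 : 0 <= k0%:R ^- 2 :> R by rewrite invr_ge0 exprn_ge0.
have h4 : 0 <= (x - osc k0) ^+ 2 by exact: sqr_ge0.
have Bw : 0 <= B * wt k0 by rewrite mulr_ge0// ltW.
move: h1 h2 h3 h4; set X := (x - _) ^+ 2; set Z := k0%:R ^- 2 => h1 h2 h3 h4.
have X0 : 0 <= X + 6 * Z by lra.
have X7 : X + 6 * Z <= 7 by lra.
by have := ler_pM Bw X0 Bk0 X7; lra.
Qed.

(** Boundedness comes from level 0 alone: the roots are untranslated, hence bounded by [2 * M], and
    their strips have half-width at most 7. *)
Lemma stripK_compact : compact stripK.
Proof.
pose Y := 2 * M + 7.
pose Q : set (R * R) := `[2 / 5, 3 / 5]%classic `*` `[- Y, Y]%classic.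
have cQ : compact Q by apply: compact_setX; exact: segment_compact.
apply: (subclosed_compact stripK_closed cQ).
move=> z [zI /(_ 0%N)[i vi zi]]; split => //=.
rewrite in_itv/= -ler_norml.
have -> : z.2 = (z.2 - branch 0 i z.1) + branch 0 i z.1 by ring.
apply: le_trans (ler_normD _ _) _.
have r7 := rad0_le zI.
have : `|branch 0 i z.1| <= 2 * M.
  have /andP[a1 a2] := valid_param vi.
  rewrite /branch /dilate addr0 normrM ler_pM// ?fM//; last first.
    exact: (sub_node_itv vi zI).
  by rewrite ger0_norm; lra.
by rewrite /Y; lra.
Qed.

Lemma truncn_half (y : R) : 0 <= y -> (Num.truncn (2 * y))./2 = Num.truncn y.
Proof.
move=> y0; apply/esym/truncn_def.
have /andP[h1 h2] := @truncn_itv R (2 * y) ltac:(lra).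
set i := Num.truncn _ in h1 h2 *.
have e : i%:R = (odd i)%:R + 2 * i./2%:R :> R.
  by rewrite -{1}(odd_double_half i) natrD -mul2n natrM.
move: h1 h2; rewrite -!natr1 e; case: (odd i) => /=; lra.
Qed.

(** * The limit curve with parameter [a] along its path of binary digits *)

Section Curve.
Context (a : R) (aI : a \in `[1, 2]).

Definition index (j : nat) : nat := Num.truncn (a * 2 ^+ (k0 + j)).

Let a0 n : 0 <= a * 2 ^+ n.
Proof. by rewrite mulr_ge0 ?exprn_ge0//; move: aI; rewrite in_itv/=; lra. Qed.

Lemma index_half j : (index j.+1)./2 = index j.
Proof. by rewrite /index addnS exprS mulrCA truncn_half. Qed.

Lemma index_valid j : valid j (index j).
Proof.
have X0 n : 0 < 2 ^+ n :> R by rewrite exprn_gt0.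
move: aI; rewrite in_itv/= => /andP[a1 a2].
rewrite /valid /index truncn_ge_nat// natrX ler_peMl ?(ltW (X0 _))//=.
rewrite -(ler_nat R) natrX exprS; apply: le_trans (ler_wpM2r (ltW (X0 _)) a2).
by rewrite truncn_le.
Qed.

Lemma index_cvg : (fun j => (index j)%:R * wt (k0 + j)) @ \oo --> a.
Proof.
have wz : (fun j => wt (k0 + j)) @ \oo --> (0 : R).
  have -> : (fun j => wt (k0 + j)) = geometric (wt k0) 2^-1.
    by apply/funext => j; rewrite /wt exprD.
  by apply: cvg_geometric; rewrite ger0_norm; lra.
have l : (fun j => a - wt (k0 + j)) @ \oo --> a.
  by rewrite -[X in _ --> X]subr0; apply: cvgB => //; exact: cvg_cst.
apply: (squeeze_cvgr _ l (cvg_cst a)); apply: nearW => j.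
have w0 := wt_gt0 (k0 + j).
have /andP[h1 h2] := truncn_itv (a0 (k0 + j)).
have E : a * 2 ^+ (k0 + j) * wt (k0 + j) = a.
  by have := natX2_wt (k0 + j); rewrite natrX -mulrA => ->; rewrite mulr1.
have g1 := ler_wpM2r (ltW w0) h1; have g2 := ler_wpM2r (ltW w0) (ltW h2).
by move: g1 g2; rewrite E -(natr1 (index j)) mulrDl mul1r -/(index j); lra.
Qed.

(** Telescoping along the path by [rad_step]; the subtracted term [rad (j + l) x] is what pays for
    the next step of the induction. *)
Lemma branch_index_le j l (x : R) : x \in `[2 / 5, 3 / 5] ->
  `|branch (j + l) (index (j + l)) x - branch j (index j) x| <= rad j x - rad (j + l) x.
Proof.
move=> xI; elim: l => [|l IH]; first by rewrite addn0 !subrr normr0.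
rewrite addnS; have [_ _ /(_ _ xI) s] := node_step (index_valid (j + l).+1).
rewrite index_half in s; have := rad_step (j + l) x.
set u := branch _ _ _ in s *; set v := branch _ _ _ in s IH.
have -> : u - branch j (index j) x = (u - v) + (v - branch j (index j) x) by ring.
by move=> h; apply: le_trans (ler_normD _ _) _; lra.
Qed.

(** The translations along the path move by geometrically decreasing steps, hence converge;
    membership in every strip follows by passing to the limit in [branch_index_le]. *)
Lemma stripK_curve : exists xi eta, xi \in `[- (1 / 5), 1 / 5] /\
  forall t, xi + t \in `[2 / 5, 3 / 5] -> stripK (xi + t, eta + a * f t).
Proof.
pose u j := (node j (index j)).1; pose v j := (node j (index j)).2.
have wE j : B * wt (k0 + j).+1 = B * wt k0.+1 * wt j.
  by rewrite /wt -addSn exprD mulrA.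
have cu : cvgn u.
  apply: (@cvgn_geometric_steps _ (B * wt k0.+1)) => j.
  by have [s _ _] := node_step (index_valid j.+1); rewrite -wE /u -(index_half j).
have cv : cvgn v.
  apply: (@cvgn_geometric_steps _ (B * wt k0.+1)) => j.
  by have [_ s _] := node_step (index_valid j.+1); rewrite -wE /v -(index_half j).
have uI j : - (1 / 5) <= u j <= 1 / 5.
  by have := node_itv (index_valid j); rewrite in_itv.
have xiI : limn u \in `[- (1 / 5), 1 / 5].
  rewrite in_itv/=; apply/andP; split.
    by apply: limr_ge => //; apply: nearW => j; case/andP: (uI j).
  by apply: limr_le => //; apply: nearW => j; case/andP: (uI j).
exists (limn u), (limn v); split => // t tI; split => //= j.
exists (index j); first exact: index_valid.
set x := limn u + t in tI *.
have tE : t = x - limn u by rewrite /x; ring.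
have fx : f (x - u l) @[l --> \oo] --> f t.
  have xu : x - u l @[l --> \oo] --> t.
    by rewrite tE; apply: cvgB => //; exact: cvg_cst.
  apply: (cvg_comp _ _ xu); apply: fc; move: xiI tI; rewrite tE !in_itv/=; lra.
have bx : branch l (index l) x @[l --> \oo] --> limn v + a * f t.
  by rewrite addrC; exact: (cvgD (cvgM index_cvg fx) cv).
have nx : `|branch l (index l) x - branch j (index j) x| @[l --> \oo] -->
    `|limn v + a * f t - branch j (index j) x|.
  by apply: cvg_norm; apply: cvgB => //; exact: cvg_cst.
rewrite -(cvg_lim _ nx)//; apply: limr_le; first by apply: cvgP nx.
exists j => // l /= jl.
have := branch_index_le j (l - j) tI; rewrite subnKC// => h.
by have := rad_ge0 l x; lra.
Qed.

End Curve.

(** * The measure of the thickened set *)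

Local Notation mu := (@lebesgue_measure R).

(** Valid indices are at most [2 ^ (k0 + j).+1], so they are among the first [2 ^ (k0 + j).+1 + 1]
    naturals; the smaller, invalid indices only enlarge the cover. *)
Lemma vthick_stripK_section j (x delta : R) : 0 <= delta ->
  (mu (xsection (vthick stripK delta) x) <=
     ((2 ^ (k0 + j).+1).+1%:R * (2 * (rad j x + delta)))%:E)%E.
Proof.
move=> d0; apply: (@mu_finite_cover _ _ (fun i => branch j i x)).
- apply: measurable_xsection; apply: compact_prod_measurable.
  by apply: vthick_compact; exact: stripK_compact.
- by rewrite addr_ge0// rad_ge0.
move=> y; rewrite /xsection/= inE => -[[x' y'] [e [[/= x'I /(_ j)[i vi hi]] eI [-> ->]]]].
exists i; first by case/andP: vi.
have -> : y' + e - branch j i x' = (y' - branch j i x') + e by ring.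
by apply: le_trans (ler_normD _ _) (lerD hi _); rewrite ler_norml.
Qed.

(* Above [x] the covering is taken at a level [n] comparable to [ln delta^-1]
   for which the tangency abscissa [osc n] is within [1 / n] of [x]. *)
Lemma leb2_vthick_stripK : exists C L0 : R, 0 < C /\ forall delta : R, 0 < delta ->
  L0 <= ln delta^-1 -> (leb2 (vthick stripK delta) <= (C * ln delta^-1 ^- 2)%:E)%E.
Proof.
have [C0 C01 dense] := @osc_dense R.
have k0R : 1 <= k0%:R :> R by rewrite ler1n.
(* With [P = 2 ^ n]: 6 comes from [2 * (2 * P + 1) <= 6 * P], [14 * B] from [rad] when the abscissa
   is within [1/n], [4 * C0 ^+ 2] from [n >= L / (2 * C0)], and 8 from [P * delta <= 8 * L ^- 2]. *)
pose C := 6 * (14 * B * (4 * C0 ^+ 2) + 8).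
have Cpos : 0 < C.
  have : 0 <= 14 * B * (4 * C0 ^+ 2) by apply: mulr_ge0; apply: mulr_ge0 => //; exact: sqr_ge0.
  by rewrite /C; lra.
exists C, (2 * C0 * k0%:R); split => // delta d0; set L := ln delta^-1 => hL.
have k2 : 2 <= 2 * C0 * k0%:R.
  by have := ler_pM ler01 ler01 C01 k0R; lra.
have L0 : 0 < L by lra.
have LV0 : 0 <= C * L ^- 2 by rewrite mulr_ge0 ?ltW// invr_gt0 exprn_gt0.
apply: (@le_trans _ _ (C * L ^- 2 * (3 / 5 - 2 / 5))%:E); last first.
  by rewrite lee_fin ler_piMr//; lra.
apply: leb2_le => //; first lra; last first.
  move=> x xI; apply/seteqP; split => // y.
  by rewrite /xsection/= inE => -[z [e [[zI _] _ [xz _]]]]; move: xI; rewrite xz zI.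
move=> x xI.
have C0p : 0 < C0 by lra.
(* This starting point gives [L / (2 * C0) <= n <= L / 2]: the lower end makes [n] at least [k0] and
   [1/n] of order [1/L], the upper end keeps [2 ^ n] below [expR (L / 2)]. *)
have [|n [n0 /andP[n1 n2] xn]] := dense x (L / (2 * C0)) xI.
  rewrite ler_pdivlMr; last lra.
  apply: le_trans hL; rewrite mul1r ler_peMr//; lra.
have nR : 0 < n%:R :> R by rewrite ltr0n.
have kn : (k0 <= n)%N.
  rewrite -(ler_nat R); apply: le_trans n1.
  by rewrite ler_pdivlMr; [rewrite mulrC | lra].
have := @vthick_stripK_section (n - k0) x delta (ltW d0).
rewrite subnKC// => /le_trans; apply; rewrite lee_fin.
have r1 : rad (n - k0) x <= 14 * B * wt n * n%:R ^- 2.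
  rewrite /rad subnKC//.
  have h : (x - osc n) ^+ 2 <= n%:R ^- 2.
    rewrite -real_normK ?num_real// -exprVn.
    by apply: lerXn2r; rewrite // nnegrE ?invr_ge0 ?(ltW nR).
  have Bw : 0 <= B * wt n by rewrite mulr_ge0// ltW// wt_gt0.
  move: h; set X := (x - _) ^+ 2; set Z := n%:R ^- 2 => h.
  by have := ler_wpM2l Bw h; lra.
have P1 := natX2_wt n; have w0 := wt_gt0 n; have PE : (2 ^ n.+1).+1%:R = 2 * (2 ^ n)%:R + 1 :> R.
  by rewrite -natr1 expnS natrM.
set P := (2 ^ n)%:R : R in P1 PE.
have P1' : 1 <= P by rewrite /P ler1n expn_gt0.
rewrite PE.
(* As [delta = expR (- L)], the product is at most [expR (- (L / 2))], and the exponential dominates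
   half the square. *)
have Pd : P * delta <= 8 * L ^- 2.
  have PeL : P <= expR (L / 2).
    have PX : P <= expR (n%:R).
      rewrite /P natrX -[n%:R]mul1r expRM_natr.
      by apply: lerXn2r; rewrite ?nnegrE ?expR_ge0//; have := @expR_ge1Dx R 1; lra.
    apply: le_trans PX _; rewrite ler_expR; apply: le_trans n2 _.
    have -> : C0 * (L / (2 * C0)) = L / 2 by field; rewrite gt_eqF.
    exact: lexx.
  have dE : delta = expR (- L).
    by rewrite /L lnV ?posrE// opprK lnK ?posrE.
  have e2 : (L / 2) ^+ 2 / 2 <= expR (L / 2).
    have := @expR_ge1Dxn R (L / 2) 1 ltac:(lra).
    have -> : 2`!%:R = 2 :> R by [].
    by set X := (L / 2) ^+ 2; lra.
  have : P * delta <= (expR (L / 2))^-1.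
    rewrite dE -expRN.
    have -> : - L = - (L / 2) - L / 2 by field.
    by rewrite expRD [X in _ * (_ * X)]expRN mulrCA ler_piMr ?expR_ge0// ler_pdivrMr ?expR_gt0// mul1r.
  move=> h; apply: le_trans h _.
  have -> : 8 * L ^- 2 = ((L / 2) ^+ 2 / 2)^-1 by field; rewrite gt_eqF.
  by rewrite lef_pV2 ?posrE ?expR_gt0// divr_gt0// exprn_gt0// divr_gt0.
have nL : n%:R ^- 2 <= 4 * C0 ^+ 2 * L ^- 2.
  have -> : 4 * C0 ^+ 2 * L ^- 2 = (L / (2 * C0)) ^- 2 by field; rewrite !gt_eqF.
  have q0 : 0 < L / (2 * C0) by rewrite divr_gt0//; lra.
  by rewrite lef_pV2 ?posrE ?exprn_gt0// lerXn2r ?nnegrE// ltW.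
have rd0 : 0 <= rad (n - k0) x + delta by rewrite addr_ge0 ?rad_ge0// ltW.
apply: (@le_trans _ _ (6 * (P * (rad (n - k0) x + delta)))).
  have := ler_wpM2r rd0 P1'; lra.
rewrite /C -mulrA ler_wpM2l// mulrDr [leRHS]mulrDl lerD//.
apply: (@le_trans _ _ (P * (14 * B * wt n * n%:R ^- 2))).
  by rewrite ler_wpM2l//; lra.
have -> : P * (14 * B * wt n * n%:R ^- 2) = 14 * B * (P * wt n) * n%:R ^- 2 by ring.
have B14 : 0 <= 14 * B by rewrite mulr_ge0.
by rewrite P1 mulr1; apply: le_trans (ler_wpM2l B14 nL) _; rewrite [leLHS]mulrA.
Qed.

End Tree.

(** * Choice of the constants, and transfer to the maximal operators *)

Section Main.
Context {R : realType}.

Lemma bounded_of_derive (g g' : R -> R) (M : R) :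
  (forall x : R, x \in `]0, 1[ -> is_derive x 1 g (g' x)) ->
  (forall x : R, x \in `]0, 1[ -> `|g' x| <= M) ->
  forall x : R, x \in `]0, 1[ -> `|g x| <= M + `|g (1 / 2)|.
Proof.
move=> dg gM x xI; have hI : (1 / 2 : R) \in `]0, 1[ by rewrite in_itv/=; lra.
have M0 : 0 <= M := le_trans (normr_ge0 _) (gM _ hI).
have h := MVT_lipschitz dg gM xI hI.
have -> : g x = (g x - g (1 / 2)) + g (1 / 2) by ring.
apply: le_trans (ler_normD _ _) _; rewrite lerD2r; apply: le_trans h _.
by rewrite ler_piMr// ler_norml; move: xI; rewrite in_itv/=; lra.
Qed.

Lemma wt_small (e : R) : 0 < e -> exists2 n, (0 < n)%N & wt n <= e.
Proof.
move=> e0; exists (Num.truncn e^-1).+1 => //.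
have /andP[_ h] := truncn_itv (ltW (eqbRL (invr_gt0 e) e0)).
set n := (Num.truncn _).+1 in h *.
have n0 : 0 < n%:R :> R by rewrite ltr0n.
apply: (@le_trans _ _ n%:R^-1).
  rewrite /wt exprVn lef_pV2 ?posrE ?exprn_gt0// -natrX ler_nat.
  by rewrite ltnW// ltn_expl.
by rewrite -[leRHS]invrK lef_pV2 ?posrE ?invr_gt0// ltW.
Qed.

Lemma thin_set_exists (f f1 f2 f3 : R -> R) :
  deriv01 f f1 -> deriv01 f1 f2 -> 0 < inf [set f2 x | x in `[0, 1]] ->
  (forall x : R, x \in `]0, 1[ -> is_derive x 1 f2 (f3 x)) ->
  (exists M : R, forall x : R, x \in `]0, 1[ -> `|f3 x| <= M) ->
  exists K : set (R * R), [/\ compact K,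
    (forall a : R, a \in `[1, 2] -> exists x1 x2 u v : R,
       [/\ 0 <= u, v <= 1, 1 / 5 <= v - u &
        forall t : R, t \in `[u, v] -> K (x1 + t, x2 + a * f t)]) &
    exists C L0 : R, 0 < C /\ forall delta : R, 0 < delta -> L0 <= ln delta^-1 ->
      (leb2 (vthick K delta) <= (C * ln delta^-1 ^- 2)%:E)%E].
Proof.
move=> hf1 hf2 hinf df2 [M3 f3M].
have df (x : R) : x \in `]0, 1[ -> is_derive x 1 f (f1 x) by exact: deriv01_is_derive.
have df1 (x : R) : x \in `]0, 1[ -> is_derive x 1 f1 (f2 x) by exact: deriv01_is_derive.
set m := inf _ in hinf.
have f2m (x : R) : x \in `]0, 1[ -> m <= f2 x.
  (* [inf] takes the default value 0 on a set without infimum, so its positivity forces the values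
     of [f2] to be bounded below. *)
  move=> xI; have [[_ lb]|ninf] := pselect (has_inf [set f2 x | x in `[0, 1]]).
    by apply: ge_inf => //; exists x => //; exact: subset_itv_oo_cc xI.
  by move: hinf; rewrite /m inf_out// ltxx.
have f2M := bounded_of_derive df2 f3M.
have f1M := bounded_of_derive df1 f2M.
have fM := bounded_of_derive df f1M.
(* Each integration adds a nonnegative term, so the bound obtained last dominates those for [f1],
   [f2] and [f3]. *)
set M := (X in forall x, _ -> `|f x| <= X) in fM.
have weaken (g : R -> R) (N : R) : (forall x : R, x \in `]0, 1[ -> `|g x| <= N) ->
    N <= M -> forall x : R, x \in `]0, 1[ -> `|g x| <= M.
  by move=> gN NM x /gN /le_trans; apply.
have := (normr_ge0 (f2 (1 / 2)), normr_ge0 (f1 (1 / 2)), normr_ge0 (f (1 / 2))) => -[[n2 n1] n0].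
have {}f1M := weaken _ _ f1M ltac:(rewrite /M; lra).
have {}f2M := weaken _ _ f2M ltac:(rewrite /M; lra).
have {}f3M := weaken _ _ f3M ltac:(rewrite /M; lra).
have hI : (1 / 2 : R) \in `]0, 1[ by rewrite in_itv/=; lra.
have M0 : 0 <= M := le_trans (normr_ge0 _) (fM _ hI).
have B0 := step_cst_ge0 hinf fM.
set B := step_cst m M in B0.
have M1 : 0 < M + 1 by lra.
have B1 : 0 < B + 1 by lra.
(* The first bound lets every tangency point be found, the second keeps the total horizontal shift
   below [1 / 5]; adding 1 avoids a zero denominator. *)
have e0 : 0 < Num.min (m / 10 / (M + 1)) (1 / 5 / (B + 1)).
  by rewrite lt_min; apply/andP; split; apply: divr_gt0 => //; lra.
have [k0 k0_gt0 hk0] := wt_small e0.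
have w0 := @wt_gt0 R k0.
move: hk0; rewrite le_min => /andP[]; rewrite !ler_pdivlMr// => hM hB.
have Bk0 : B * wt k0 <= 1 / 5 by lra.
have [st stP] : exists st : R * R * (R * R) * R -> R * R, forall q,
    1 <= q.1.1.1 <= 2 -> 0 <= q.1.1.2 <= wt k0 ->
    q.1.2.1 \in `[- (1 / 5), 1 / 5] -> q.2 \in `[2 / 5, 3 / 5] ->
    [/\ `|(st q).1 - q.1.2.1| <= B * q.1.1.2, `|(st q).2 - q.1.2.2| <= B * q.1.1.2 &
    forall x : R, x \in `[2 / 5, 3 / 5] ->
      `|dilate f (q.1.1.1 + q.1.1.2) (st q).1 (st q).2 x - dilate f q.1.1.1 q.1.2.1 q.1.2.2 x| <=
        B * q.1.1.2 * (x - q.2) ^+ 2].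
  (* The range conditions stand under the existential, so that arguments out of range can receive
     the dummy value [(0, 0)] and choice applies. *)
  suff /choice[st stP] : forall q : R * R * (R * R) * R, exists s : R * R,
    1 <= q.1.1.1 <= 2 -> 0 <= q.1.1.2 <= wt k0 ->
    q.1.2.1 \in `[- (1 / 5), 1 / 5] -> q.2 \in `[2 / 5, 3 / 5] ->
    [/\ `|s.1 - q.1.2.1| <= B * q.1.1.2, `|s.2 - q.1.2.2| <= B * q.1.1.2 &
    forall x : R, x \in `[2 / 5, 3 / 5] ->
      `|dilate f (q.1.1.1 + q.1.1.2) s.1 s.2 x - dilate f q.1.1.1 q.1.2.1 q.1.2.2 x| <=
        B * q.1.1.2 * (x - q.2) ^+ 2] by exists st.
  move=> [[[a h] [xi eta]] x0] /=.
  have [aI|naI] := boolP (1 <= a <= 2); last by exists (0, 0).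
  have [/andP[h0 hk]|nhI] := boolP (0 <= h <= wt k0); last by exists (0, 0).
  have [xiI|nxiI] := boolP (xi \in `[- (1 / 5), 1 / 5]); last by exists (0, 0).
  have [x0I|nx0I] := boolP (x0 \in `[2 / 5, 3 / 5]); last by exists (0, 0).
  have Mh : M * h <= m / 10.
    by have := ler_wpM2l M0 hk; lra.
  have [xi' [eta' H]] := tangent_step df df1 df2 hinf fM f1M f2m f2M f3M eta aI h0 Mh xiI x0I.
  by exists (xi', eta') => _ _ _ _.
pose step a h p x0 := st (a, h, p, x0).
have stepP (a h : R) (p : R * R) (x0 : R) : 1 <= a <= 2 -> 0 <= h <= wt k0 ->
  p.1 \in `[- (1 / 5), 1 / 5] -> x0 \in `[2 / 5, 3 / 5] ->
  [/\ `|(step a h p x0).1 - p.1| <= B * h, `|(step a h p x0).2 - p.2| <= B * h &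
    forall x : R, x \in `[2 / 5, 3 / 5] ->
      `|dilate f (a + h) (step a h p x0).1 (step a h p x0).2 x - dilate f a p.1 p.2 x| <=
        B * h * (x - x0) ^+ 2] := stP (a, h, p, x0).
have fc (x : R) : x \in `]0, 1[ -> {for x, continuous f}.
  move=> /df[dx _].
  by apply: differentiable_continuous; apply/derivable1_diffP.
exists (stripK f B k0 step); split.
- exact: (stripK_compact fc fM B0 k0_gt0 Bk0 stepP).
- move=> a aI; have [xi [eta [xiI hK]]] := stripK_curve fc B0 k0_gt0 Bk0 stepP aI.
  (* The piece above the window [[2/5, 3/5]]; it stays inside [[0, 1]] because [xi] is at most
     [1 / 5] in absolute value. *)
  exists xi, eta, (2 / 5 - xi), (3 / 5 - xi).
  split; [move: xiI; rewrite in_itv/=; lra | move: xiI; rewrite in_itv/=; lra | lra |].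
  by move=> t tI; apply: hK; move: tI; rewrite !in_itv/=; lra.
- exact: (leb2_vthick_stripK fc fM B0 k0_gt0 Bk0 stepP).
Qed.

Lemma sub_vthick (K : set (R * R)) (delta : R) : 0 <= delta -> K `<=` vthick K delta.
Proof.
move=> d0 z Kz; exists z, 0; split => //; first by rewrite oppr_le0 d0.
by case: z {Kz} => x y /=; rewrite addr0.
Qed.

(** Each section above [[u, v]] contains an interval of length [2 * delta]. Positivity makes the
    indicator an admissible test function. *)
Lemma leb2_vthick_gt0 (K : set (R * R)) (phi : R -> R) (u v delta : R) :
  compact K -> u < v -> 0 < delta -> (forall x : R, x \in `[u, v] -> K (x, phi x)) ->
  (0 < leb2 (vthick K delta))%E.
Proof.
move=> cK uv d0 hK.
have mV : measurable (vthick K delta).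
  by apply: compact_prod_measurable; exact: vthick_compact.
apply: (@lt_le_trans _ _ (2 * delta * (v - u))%:E).
  by rewrite lte_fin !mulr_gt0// subr_gt0.
apply: leb2_ge => [||x xI]; [exact: ltW | lra |].
have -> : (2 * delta)%:E = lebesgue_measure `[phi x - delta, phi x + delta]%classic.
  by rewrite lebesgue_measure_itvcc; [congr (_%:E); ring | lra].
apply: le_measure; rewrite ?inE//; first exact: measurable_xsection.
move=> y /=; rewrite in_itv/= => yI; rewrite /xsection/= inE.
by exists (x, phi x), (y - phi x); split => //=; [exact: hK | lra | congr (_, _); ring].
Qed.

(** Taking [delta = expR (- L)] bounds the measure of [K] by [C * L ^- 2] for all large [L]. *)
Lemma leb2_eq0 (K : set (R * R)) (C L0 : R) : compact K -> 0 < C ->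
  (forall delta : R, 0 < delta -> L0 <= ln delta^-1 ->
    (leb2 (vthick K delta) <= (C * ln delta^-1 ^- 2)%:E)%E) -> leb2 K = 0%E.
Proof.
move=> cK C0 hC.
have mK : measurable K := compact_prod_measurable cK.
have h (L : R) : 0 < L -> L0 <= L -> (leb2 K <= (C * L ^- 2)%:E)%E.
  move=> Lp LL0.
  have lE : ln (expR (- L))^-1 = L by rewrite expRN invrK expRK.
  have := hC _ (expR_gt0 (- L)); rewrite lE => /(_ LL0); apply: le_trans.
  have mV : measurable (vthick K (expR (- L))).
    by apply: compact_prod_measurable; exact: vthick_compact.
  exact: (@le_measure _ _ _ (lebesgue_measure \x lebesgue_measure)%E K _
    (mem_set mK) (mem_set mV) (sub_vthick (expR_ge0 _))).
have K0 : (0 <= leb2 K)%E by exact: measure_ge0.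
have [k kE] : exists k, leb2 K = k%:E.
  have := h (Num.max L0 1); rewrite lt_max ltr01 orbT le_max lexx => /(_ isT isT).
  by case: (leb2 K) K0 => // k _ _; exists k.
move: K0; rewrite kE lee_fin le_eqVlt => /predU1P[<-//|k0].
have CK : 0 <= C / k by rewrite divr_ge0// ltW.
pose L := `|L0| + C / k + 1.
have aL := normr_ge0 L0.
have L1 : 1 <= L by rewrite /L; lra.
have := h L ltac:(lra) ltac:(have := ler_norm L0; rewrite /L; lra).
rewrite kE lee_fin ler_pdivlMr; last by rewrite exprn_gt0//; lra.
move=> kL; have : k * L <= k * L ^+ 2.
  by rewrite ler_wpM2l ?(ltW k0)// expr2 ler_peMr//; lra.
have : C < k * L.
  by rewrite mulrC -ltr_pdivrMr// /L; lra.
by move=> h1 h2; exfalso; lra.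
Qed.

End Main.

Theorem theorem1p3 (R : realType) (f f1 f2 f3 : R -> R)
  (hf1 : deriv01 f f1) (hf2 : deriv01 f1 f2)
  (hf2c : {within `[0, 1], continuous f2})
  (hf10 : 0 <= f1 0)
  (hinf : 0 < inf [set f2 x | x in `[0, 1]])
  (hf3 : forall x : R, x \in `]0, 1[ -> is_derive x 1 f2 (f3 x))
  (hf3b : exists M : R, forall x : R, x \in `]0, 1[ -> `|f3 x| <= M)
  (hcurv : forall x : R, x \in `]0, 1[ -> f1 x * f3 x - f2 x ^+ 2 <= 0) :
  (exists K : set (R * R),
     [/\ compact K, leb2 K = 0%E,
         (exists c : R, 0 < c /\
            forall a : R, a \in `[1, 2] ->
              exists (x1 x2 u v : R),
                [/\ 0 <= u, v <= 1, c <= v - u &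
                    forall t : R, t \in `[u, v] -> K (x1 + t, x2 + a * f t)])
       & (exists C delta0 : R, 0 < delta0 /\
            forall delta : R, 0 < delta < delta0 ->
              (leb2 (vthick K delta) <= (C * (ln delta^-1) ^- 2)%:E)%E)])
  /\ (forall p q : \bar R, (1%:E <= p)%E -> (1%:E <= q)%E ->
        exists c : R, 0 < c /\ exists delta0 : R, 0 < delta0 /\
          forall delta : R, 0 < delta < delta0 ->
            ((c * powR (ln delta^-1) (two_over p))%:E <= Rpqd f p q delta)%E)
  /\ (forall p q : \bar R, (1%:E <= p)%E -> (1%:E <= q)%E -> (p < +oo)%E ->
        Rpq f p q = +oo%E).
Proof.
have [K [cK curves [C [L0 [C0 hC]]]]] := thin_set_exists hf1 hf2 hinf hf3 hf3b.
have c0 : 0 < 1 / 5 :> R by lra.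
have small (L delta : R) : 0 < delta < expR (- L) -> L <= ln delta^-1.
  move=> /andP[d0 dL]; rewrite lnV ?posrE// lerNr -[leRHS]expRK.
  by rewrite ler_ln ?posrE ?expR_gt0// ltW.
(* The maximum with 1 makes the logarithm positive as well. *)
pose L1 := Num.max L0 1.
have L1P (delta : R) : 0 < delta < expR (- L1) -> 0 < ln delta^-1 /\ L0 <= ln delta^-1.
  move=> /small; rewrite /L1 ge_max => /andP[h1 h2]; split => //.
  exact: lt_le_trans h2.
have mV (delta : R) : measurable (vthick K delta).
  by apply: compact_prod_measurable; exact: vthick_compact.
have Vpos (delta : R) : 0 < delta -> (0 < leb2 (vthick K delta))%E.
  move=> d0; have [|x1 [x2 [u [v [u0 v1 uv hK]]]]] := curves 1.
    by rewrite in_itv/=; lra.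
  apply: (@leb2_vthick_gt0 _ _ (fun x => x2 + 1 * f (x - x1)) (x1 + u) (x1 + v)) => //.
    by lra.
  move=> x xI; have xE : x1 + (x - x1) = x by ring.
  have := hK (x - x1); rewrite xE; apply.
  by move: xI; rewrite !in_itv/=; lra.
have Cp (p : \bar R) : 0 < 1 / 5 / C `^ (two_over p / 2).
  by rewrite divr_gt0// powR_gt0.
split; last split.
- exists K; split => //; first exact: leb2_eq0 hC.
    by exists (1 / 5); split.
  exists C, (expR (- L1)); split; first exact: expR_gt0.
  by move=> delta dI; have [_ h] := L1P _ dI; apply: hC => //; case/andP: dI.
- move=> p q p1 q1; exists (1 / 5 / C `^ (two_over p / 2)); split => //.
  exists (expR (- L1)); split; first exact: expR_gt0.
  move=> delta dI; have [Lp LL0] := L1P _ dI; have d0 : 0 < delta by case/andP: dI.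
  apply: (ratio_cindic_ge (A := vthick K delta)) => //.
    by rewrite Vpos// hC.
  move=> a aI; have [x1 [x2 [u [v [u0 v1 uv hK]]]]] := curves a aI.
  apply: (@le_trans _ _ (v - u)%:E); first by rewrite lee_fin.
  apply: (@Rdeltaop_cindic_ge _ _ _ _ _ x1 x2) => //; first lra.
  move=> t s tI sI; exists (x1 + t, x2 + a * f t), s.
  by split => //; exact: hK.
- move=> p q p1 q1 py.
  have [r r0 rE] : exists2 r : R, 0 < r & two_over p = 2 / r.
    case: p p1 py => [r|//|//]; rewrite lee_fin => r1 _.
    by exists r => //; exact: lt_le_trans r1.
  apply: eq_infty => T.
  pose c := 1 / 5 / C `^ (two_over p / 2).
  have c_gt0 : 0 < c := Cp p.
  pose S := Num.max 1 (T / c).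
  have S1 : 1 <= S by rewrite le_max lexx.
  (* The second entry makes [L] to the power [2 / r] at least [T / c]; the first puts [delta]
     strictly below the threshold. *)
  pose L := Num.max (L1 + 1) (S `^ (r / 2)).
  pose delta := expR (- L).
  have lE : ln delta^-1 = L by rewrite /delta expRN invrK expRK.
  have d0 : 0 < delta := expR_gt0 _.
  have dI : 0 < delta < expR (- L1).
    by rewrite d0 ltr_expR ltrN2 /L lt_max ltrDl ltr01.
  have [Lp LL0] := L1P _ dI.
  (* The same thickened indicator serves for the operator without averaging, as the curves in [K]
     lie in the thickening. *)
  have ratio : ((c * L `^ two_over p)%:E <= Rpq f p q)%E.
    rewrite -lE; apply: (ratio_cindic_ge (A := vthick K delta)) => //.
      by rewrite Vpos// hC.
    move=> a aI; have [x1 [x2 [u [v [u0 v1 uv hK]]]]] := curves a aI.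
    apply: (@le_trans _ _ (v - u)%:E); first by rewrite lee_fin.
    apply: (@Rmaxop_cindic_ge _ _ _ _ x1 x2) => //; first lra.
    by move=> t tI; apply: (sub_vthick (ltW d0)); exact: hK.
  apply: le_trans ratio; rewrite lee_fin mulrC -ler_pdivrMr//.
  apply: (@le_trans _ _ S); first by rewrite /S le_max lexx orbT.
  have -> : S = (S `^ (r / 2)) `^ two_over p.
    rewrite rE -powRrM.
    have -> : r / 2 * (2 / r) = 1 by field; rewrite gt_eqF.
    by rewrite powRr1//; lra.
  apply: ge0_ler_powR; rewrite ?nnegrE ?powR_ge0//.
  + by rewrite rE divr_ge0// ltW.
  + by rewrite -lE ltW.
  + by rewrite /L le_max lexx orbT.
Qed.
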